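(* Let $(G,\mu)$ be a multiplicative group, let $K\ge 1$, and let $A,B$ be multiplicative sets. Then the following four statements are equivalent, in the sense that if one of them holds for one choice of the implied absolute constants in the $O()$, $\lesssim$, $\gtrsim$, $\sim$ notation, then the other statements hold for some (possibly different) choice of absolute constants: (i) $\mathrm{E}(A,B) \gtrsim K^{O(1)}\mu(A)^{3/2}\mu(B)^{3/2}$. (ii) There exists an open subset $E\subseteq A\times B$ with $\mu\otimes\mu(E)\gtrsim K^{O(1)}\mu(A)\mu(B)$ such that $\mu(\{a\cdot b:(a,b)\in E\})\lesssim K^{O(1)}\mu(A)^{1/2}\mu(B)^{1/2}$. (iii) There exist multiplicative sets $A'\subseteq A$, $B'\subseteq B$ with $\mu(A')\sim K^{O(1)}\mu(A)$, $\mu(B')\sim K^{O(1)}\mu(B)$ and $\mu(A'\cdot B')\sim K^{O(1)}\mu(A)^{1/2}\mu(B)^{1/2}$. (iv) There exist an $O(K^{O(1)})$-approximate group $H$ with $\mu(H)\sim K^{O(1)}\mu(A)^{1/2}\mu(B)^{1/2}$ and elements $x,y\in G$ such that $\mu(A\cap (x\cdot H))\sim K^{O(1)}\mu(A)$ and $\mu(B\cap(H\cdot y))\sim K^{O(1)}\mu(B)$.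
   Context: A multiplicative group is a topological group $G$ equipped with a non-negative Radon measure $\mu$ invariant under left translation, right translation and inversion, such that every non-empty open set has positive measure. A multiplicative set is a non-empty open precompact subset of $G$. Convolution: $f*g(x)=\int_G f(y)g(y^{-1}x)\,d\mu(y)$; $1_A$ is the indicator function of $A$. The multiplicative energy is $\mathrm{E}(A,B)=\int_G (1_A*1_B(x))^2\,d\mu(x)$. A multiplicative set $H$ is a $K$-approximate group if $H^{-1}=H$ and there is a finite symmetric set $X\subseteq H\cdot H$ with $|X|\le K$ and $H\cdot H\subseteq X\cdot H$. Notation: $X\lesssim K^{O(1)}Y$ means $X\le CK^CY$, $X\gtrsim K^{O(1)}Y$ means $X\ge C^{-1}K^{-C}Y$, $X\sim K^{O(1)}Y$ means both, for an absolute constant $C$ independent of $G,A,B,K$; $O(K^{O(1)})$ denotes a quantity at most $CK^C$. *)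

(* Defs.v *)
From HB Require Import structures.
From mathcomp Require Import all_boot all_order all_algebra.
From mathcomp Require Import finmap.
From mathcomp Require Import all_classical all_reals all_analysis.

Set Implicit Arguments.
Unset Strict Implicit.
Unset Printing Implicit Defensive.

Import Order.TTheory GRing.Theory Num.Theory.

Local Open Scope classical_set_scope.
Local Open Scope ring_scope.

HB.structure Definition PreTopologicalGroup := {G of Topological G & Group G}.

HB.mixin Record isTopologicalGroup G & PreTopologicalGroup G := {
  mulg_continuous : continuous (fun x : G * G => (x.1 * x.2)%g) ;
  invg_continuous : continuous (fun x : G => (x^-1)%g)
}.

#[short(type="topologicalGroupType")]
HB.structure Definition TopologicalGroup :=
  {G of PreTopologicalGroup G & isTopologicalGroup G}.

HB.mixin Record hasBorelMeasurable (d : measure_display) G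
    & Topological G & Measurable d G := {
  measurable_borel : @measurable d G = <<s @open G >>
}.

(* Topological groups carrying their Borel sigma-algebra. The groups are
   neither assumed to be Hausdorff nor to be second countable. *)
#[short(type="borelGroupType")]
HB.structure Definition BorelGroup (d : measure_display) :=
  {G of TopologicalGroup G & Measurable d G & hasBorelMeasurable d G}.

Section SetOperations.
Context {G : groupType}.
Implicit Types A B : set G.

Definition mulset A B : set G := [set (a * b)%g | a in A & b in B].
Definition invset A : set G := [set (a^-1)%g | a in A].
Definition lset (x : G) A : set G := [set (x * a)%g | a in A].
Definition rset A (x : G) : set G := [set (a * x)%g | a in A].

End SetOperations.

Section MultiplicativeGroups.
Context {R : realType} {d : measure_display} {G : borelGroupType d}.
Local Open Scope ereal_scope.

(* Locally finite, outer regular on Borel sets and inner regular on open sets.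
   The compact sets are also required to be closed, hence Borel; this is
   automatic when G is Hausdorff. *)
Definition radon (mu : set G -> \bar R) : Prop :=
  [/\ forall F : set G, closed F -> compact F -> mu F < +oo,
      forall A : set G, measurable A ->
        mu A = ereal_inf [set mu U | U in [set U | open U /\ A `<=` U]] &
      forall U : set G, open U ->
        mu U = ereal_sup
          [set mu F | F in [set F | [/\ closed F, compact F & F `<=` U]]]].

Definition multiplicative_group (mu : {measure set G -> \bar R}) : Prop :=
  [/\ radon mu,
      forall (x : G) (A : set G), measurable A -> mu (lset x A) = mu A,
      forall (x : G) (A : set G), measurable A -> mu (rset A x) = mu A,
      forall A : set G, measurable A -> mu (invset A) = mu A &
      forall U : set G, open U -> U !=set0 -> 0 < mu U].

Definition multiplicative_set (A : set G) : Prop :=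
  [/\ A !=set0, open A & precompact A].

Definition convolution (mu : set G -> \bar R) (f g : G -> R) (x : G) : \bar R :=
  \int[mu]_y (f y * g (y^-1 * x)%g)%:E.

Definition energy (mu : set G -> \bar R) (A B : set G) : \bar R :=
  \int[mu]_x (convolution mu \1_A \1_B x) ^+ 2.

Definition approximate_group (K : R) (H : set G) : Prop :=
  [/\ multiplicative_set H, invset H = H &
      exists X : {fset G},
        [/\ invset [set` X] = [set` X], [set` X] `<=` mulset H H,
            (#|` X|%:R <= K)%R & mulset H H `<=` mulset [set` X] H]].

End MultiplicativeGroups.

Section Asymptotics.
Context {R : realType}.
Local Open Scope ereal_scope.
Implicit Types (C K : R) (X Y : \bar R).

Definition lesssim C K X Y : Prop := X <= (C * K `^ C)%:E * Y.
Definition gtrsim C K X Y : Prop := (C^-1 * K `^ (- C))%:E * Y <= X.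
Definition sim C K X Y : Prop := lesssim C K X Y /\ gtrsim C K X Y.

End Asymptotics.

(* In each of the four statements a single C bounds all the implied constants:
   as K >= 1, every estimate above only gets weaker when C increases. *)
Section Statements.
Context {R : realType} {d : measure_display} {G : borelGroupType d}.
Variables (mu : {measure set G -> \bar R}) (C K : R) (A B : set G).
Local Open Scope ereal_scope.

Definition large_energy : Prop :=
  gtrsim C K (energy mu A B) (mu A `^ (3 / 2) * mu B `^ (3 / 2)).

(* When G is not second countable, an open subset E of G * G need not belong to
   the product of the Borel sigma-algebras. (mu \x mu) E is by definition the
   integral over x of mu (xsection E x); for open E this is also the value of the
   Radon product of mu with itself, x |-> mu (xsection E x) being then lower
   semicontinuous. *)
Definition small_partial_product_set : Prop :=
  exists E : set (G * G),
    [/\ open E, E `<=` A `*` B,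
        gtrsim C K ((mu \x mu) E) (mu A * mu B) &
        lesssim C K (mu [set (ab.1 * ab.2)%g | ab in E])
          (mu A `^ (1 / 2) * mu B `^ (1 / 2))].

Definition small_product_subsets : Prop :=
  exists A' B' : set G,
    [/\ multiplicative_set A' /\ A' `<=` A,
        multiplicative_set B' /\ B' `<=` B,
        sim C K (mu A') (mu A), sim C K (mu B') (mu B) &
        sim C K (mu (mulset A' B')) (mu A `^ (1 / 2) * mu B `^ (1 / 2))].

Definition covered_by_approximate_group : Prop :=
  exists (H : set G) (x y : G),
    [/\ approximate_group (C * K `^ C)%R H,
        sim C K (mu H) (mu A `^ (1 / 2) * mu B `^ (1 / 2)),
        sim C K (mu (A `&` lset x H)) (mu A) &
        sim C K (mu (B `&` rset H y)) (mu B)].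

End Statements.

(* Statements about mu, C, K, A, B, where C is the implied constant. *)
Definition statement (R : realType) :=
  forall (d : measure_display) (G : borelGroupType d),
    {measure set G -> \bar R} -> R -> R -> set G -> set G -> Prop.

(* The constant C' only depends on C: it is chosen before G, mu, K, A and B. *)
Definition implies_up_to_constants (R : realType) (P Q : statement R) : Prop :=
  forall C : R, 0 < C -> exists2 C' : R, 0 < C' &
    forall (d : measure_display) (G : borelGroupType d)
      (mu : {measure set G -> \bar R}), multiplicative_group mu ->
    forall K : R, 1 <= K ->
    forall A B : set G, multiplicative_set A -> multiplicative_set B ->
      P d G mu C K A B -> Q d G mu C' K A B.

Definition equivalent_up_to_constants (R : realType) (P Q : statement R) :=
  implies_up_to_constants P Q /\ implies_up_to_constants Q P.

(* Main.v *)
Require Import Defs.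
From HB Require Import structures.
From mathcomp Require Import all_boot all_order all_algebra.
From mathcomp Require Import finmap.
From mathcomp Require Import all_classical all_reals all_analysis.
From mathcomp Require Import measurable_realfun ring lra.

Set Implicit Arguments.
Unset Strict Implicit.
Unset Printing Implicit Defensive.

Import Order.TTheory GRing.Theory Num.Theory.
Import numFieldNormedType.Exports.

Local Open Scope classical_set_scope.
Local Open Scope ring_scope.

(** The statements are proved in the cycle (ii) => (iv) => (iii) => (ii), together
    with (i) <=> (ii). Shearing [(x, y)] to [(x, x y)] identifies the measure of
    a partial product set with the integral of a function below [1_A * 1_B], so
    (i) <=> (ii) is Cauchy-Schwarz in one direction and the choice of the level
    set [1_A * 1_B > t] in the other.

    For (ii) => (iv), dependent random choice yields a large [A'] in [A] in which
    every quotient [x x'^-1] has many representations as a product of two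
    popular quotients of the product set of [E]; hence [A' A'^-1] has measure
    comparable to that of [A']. The popular quotients [S] of [A'^-1] satisfy
    [m(S^n) <= K^O(n) m(A')], and covering arguments show that [S S] is an
    approximate group with a left translate meeting [A'] in a large set. The
    right translate for [B] is obtained by covering the thick columns of [E].

    As the group need not be second countable, the usual Fubini theorem does not
    apply to open subsets of [G * G]. It is replaced by Fubini for lower
    semicontinuous functions, which follows from inner regularity. *)

(** * Topological groups *)

(** Neither separation nor sigma-finiteness is available, so every set that is constructed has to be
    open and precompact: then it is Borel, has finite measure, and has positive measure once it is
    non-empty. For this reason every selection by size is a strict superlevel set of a lower
    semicontinuous function.

    Without commutativity the order of the quotients matters. The set [A' A'^-1] is the small one,
    whereas [S] lies in [A'^-1 A']; two points of one left translate of [S] have their quotient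
    [x^-1 x'] in [S S]. A coincidence [x y = x' y'] between two columns says [y = x^-1 x' y'], so
    the same group [S S] that absorbs [A] from the left absorbs [B] from the right. For this the
    rows of [E] over the selected part of [A] must still be thick, hence the thin rows are discarded
    before [A'] is chosen.

    All implied constants [C K^C] are majorized by a single real [L >= 1], and each implication
    loses at most [c L^n] with absolute [c] and [n]. *)

Lemma continuous_fst (S S' : topologicalType) : continuous (@fst S S').
Proof. by move=> x; exact: cvg_fst. Qed.

Lemma continuous_snd (S S' : topologicalType) : continuous (@snd S S').
Proof. by move=> x; exact: cvg_snd. Qed.

Lemma open_preimage (T S : topologicalType) (h : T -> S) (A : set S) :
  continuous h -> open A -> open (h @^-1` A).
Proof. by move=> /continuousP; exact. Qed.

Lemma continuous_pair (S T U : topologicalType) (f : S -> T) (g : S -> U) :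
  continuous f -> continuous g -> continuous (fun x => (f x, g x)).
Proof. by move=> cf cg x; apply: cvg_pair; [exact: cf|exact: cg]. Qed.

Lemma open_setX (S T : topologicalType) (A : set S) (B : set T) :
  open A -> open B -> open (A `*` B).
Proof.
move=> oA oB; rewrite (_ : A `*` B = (fst @^-1` A) `&` (snd @^-1` B)).
  apply: openI.
    by apply: open_preimage oA; exact: continuous_fst.
  by apply: open_preimage oB; exact: continuous_snd.
by apply/seteqP; split.
Qed.

Section ContinuousGroupOperations.
Context {G : topologicalGroupType} {T : topologicalType}.
Implicit Types f g : T -> G.

Lemma continuous_mulg f g : continuous f -> continuous g ->
  continuous (fun x => (f x * g x)%g).
Proof.
move=> cf cg x; apply: (@continuous_comp _ _ _ (fun x => (f x, g x))
  (fun p : G * G => (p.1 * p.2)%g)); last exact: mulg_continuous.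
by apply: cvg_pair; [exact: cf|exact: cg].
Qed.

Lemma continuous_invg f : continuous f -> continuous (fun x => (f x)^-1%g).
Proof.
move=> cf x; apply: (@continuous_comp _ _ _ f (fun p : G => (p^-1)%g)).
  exact: cf.
exact: invg_continuous.
Qed.

End ContinuousGroupOperations.

(** * Products, inverses and translates of sets *)

Section SetAlgebra.
Context {G : groupType}.
Implicit Types (A B C : set G) (x y : G).

Lemma lsetE x A : lset x A = [set y | A (x^-1 * y)%g].
Proof.
apply/seteqP; split=> y /=; first by move=> [a Aa <-]; rewrite mulKg.
by move=> Ay; exists (x^-1 * y)%g; rewrite ?mulVKg.
Qed.

Lemma rsetE x A : rset A x = [set y | A (y * x^-1)%g].
Proof.
apply/seteqP; split=> y /=; first by move=> [a Aa <-]; rewrite mulgK.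
by move=> Ay; exists (y * x^-1)%g; rewrite ?mulgVK.
Qed.

Lemma invsetE A : invset A = [set y | A (y^-1)%g].
Proof.
apply/seteqP; split=> y /=; first by move=> [a Aa <-]; rewrite invgK.
by move=> Ay; exists (y^-1)%g; rewrite ?invgK.
Qed.

Lemma invsetK A : invset (invset A) = A.
Proof. by rewrite !invsetE; apply/seteqP; split=> x /=; rewrite invgK. Qed.

Lemma invset_mulset A B : invset (mulset A B) = mulset (invset B) (invset A).
Proof.
rewrite [LHS]invsetE; apply/seteqP; split=> x /=.
  move=> [a Aa [b Bb e]]; exists (b^-1)%g; first by exists b.
  by exists (a^-1)%g; [exists a|rewrite -invgM e invgK].
move=> [_ [b Bb <-] [_ [a Aa <-] <-]]; exists a => //; exists b => //.
by rewrite invgM !invgK.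
Qed.

Lemma mulsetA A B C : mulset A (mulset B C) = mulset (mulset A B) C.
Proof.
apply/seteqP; split=> x /=.
  move=> [a Aa [_ [b Bb [c Cc <-]] <-]]; exists (a * b)%g.
    by exists a => //; exists b.
  by exists c => //; rewrite mulgA.
move=> [_ [a Aa [b Bb <-]] [c Cc <-]]; exists a => //; exists (b * c)%g.
  by exists b => //; exists c.
by rewrite mulgA.
Qed.

Lemma mem_mulset A B x y : A x -> B y -> mulset A B (x * y)%g.
Proof. by move=> Ax By; exists x => //; exists y. Qed.

Lemma mem_invset A x : A x -> invset A (x^-1)%g.
Proof. by move=> Ax; exists x. Qed.

End SetAlgebra.

(** * Open precompact sets *)

Section OpenPrecompact.
Context {G : topologicalGroupType}.
Implicit Types (A B K : set G) (x y : G).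

Lemma continuous_mulgl x : continuous (fun y : G => (x * y)%g).
Proof. by apply: continuous_mulg => y; [exact: cvg_cst|exact: cvg_id]. Qed.

Lemma continuous_mulgr x : continuous (fun y : G => (y * x)%g).
Proof. by apply: continuous_mulg => y; [exact: cvg_id|exact: cvg_cst]. Qed.

Lemma open_lset x A : open A -> open (lset x A).
Proof. by rewrite lsetE; apply: open_preimage; exact: continuous_mulgl. Qed.

Lemma open_rset x A : open A -> open (rset A x).
Proof. by rewrite rsetE; apply: open_preimage; exact: continuous_mulgr. Qed.

Lemma open_invset A : open A -> open (invset A).
Proof. by rewrite invsetE; apply: open_preimage; exact: invg_continuous. Qed.

Lemma open_mulset A B : open B -> open (mulset A B).
Proof.
move=> oB; rewrite (_ : mulset A B = \bigcup_(a in A) lset a B).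
  by apply: bigcup_open => a _; exact: open_lset.
apply/seteqP; split=> x.
  by move=> [a Aa [b Bb <-]]; exists a => //; exists b.
by move=> [a Aa [b Bb <-]]; exists a => //; exists b.
Qed.

(* In a group that is not Hausdorff, compact sets need not be closed. *)
Lemma compact_closure K : compact K -> compact (closure K).
Proof.
move=> /compact_near_coveringP cK; apply/compact_near_coveringP => I F P FF HP.
(* Compactness of [K] gives one neighbourhood [V] of 1 that works for all of [K]. The closure of [K]
   is contained in [K V], so the property reaches every closure point. *)
have: \forall iv \near filter_prod F (nbhs (1 : G)%g),
    K `<=` (fun k => P iv.1 (k * iv.2)%g).
  apply: (cK _ _ (fun iv k => P iv.1 (k * iv.2)%g)) => k Kk.
  have [[U A] [/= nU FA] UA] := HP k (subset_closure Kk).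
  have := @mulg_continuous G (k, 1%g).
  rewrite /continuous_at /= mulg1 => /(_ U nU) [[V W] [/= nV nW] VW].
  exists (V, A `*` W); first by split => //; exists (A, W).
  move=> [k' [i v]] [/= Vk' [Ai Wv]] /=.
  exact: (UA ((k' * v)%g, i) (conj (VW (k', v) (conj Vk' Wv)) Ai)).
move=> [[A V] [/= FA nV] AV].
apply: (filterS _ FA) => i Ai x clx.
have : continuous (fun y : G => (y^-1 * x)%g).
  by apply: continuous_mulg => y; [exact: invg_continuous|exact: cvg_cst].
move=> /(_ x); rewrite /continuous_at /= mulVg => /(_ V nV) nW.
have [k [Kk /= Vk]] := clx _ nW.
by have := AV (i, (k^-1 * x)%g) (conj Ai Vk) k Kk; rewrite /= mulVKg.
Qed.

Lemma sub_compact_precompact A K : compact K -> A `<=` K -> precompact A.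
Proof.
move=> cK sAK; exists (closure K); last first.
  by split; [exact: compact_closure|exact: closed_closure].
by move=> a Aa; apply: subset_closure; exact: sAK.
Qed.

Lemma precompact_sub_compact A : precompact A -> exists2 K, compact K & A `<=` K.
Proof. by move=> [K sAK [cK _]]; exists K. Qed.

Lemma precompact_mulset A B :
  precompact A -> precompact B -> precompact (mulset A B).
Proof.
move=> /precompact_sub_compact[K cK sAK] /precompact_sub_compact[L cL sBL].
apply: (@sub_compact_precompact _ [set (p.1 * p.2)%g | p in K `*` L]).
  apply: continuous_compact; last exact: compact_setX.
  exact/continuous_subspaceT/mulg_continuous.
move=> _ [a Aa [b Bb <-]]; exists (a, b) => //.
by split; [exact: sAK|exact: sBL].
Qed.

Lemma precompact_invset A : precompact A -> precompact (invset A).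
Proof.
move=> /precompact_sub_compact[K cK sAK].
apply: (@sub_compact_precompact _ [set (p^-1)%g | p in K]).
  apply: continuous_compact => //.
  exact/continuous_subspaceT/invg_continuous.
by move=> _ [a Aa <-]; exists a => //; exact: sAK.
Qed.

(** The working class of sets. Unlike multiplicative sets they may be empty, which makes the class
    stable under intersections and under passing to open subsets. *)
Definition opc A := open A /\ precompact A.

Lemma opc_mulset A B : opc A -> opc B -> opc (mulset A B).
Proof.
by move=> [_ pA] [oB pB]; split; [exact: open_mulset|exact: precompact_mulset].
Qed.

Lemma opc_invset A : opc A -> opc (invset A).
Proof.
by move=> [oA pA]; split; [exact: open_invset|exact: precompact_invset].
Qed.

Lemma opc_lset x A : opc A -> opc (lset x A).
Proof.
move=> [oA pA]; split; first exact: open_lset.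
rewrite (_ : lset x A = mulset [set x] A).
  apply: precompact_mulset => //.
  by apply: (@sub_compact_precompact _ [set x]) => //; exact: compact_set1.
by apply/seteqP; split=> y; [move=> [a Aa <-]; exists x => //; exists a|
  move=> [_ -> [a Aa <-]]; exists a].
Qed.

Lemma opc_rset x A : opc A -> opc (rset A x).
Proof.
move=> [oA pA]; split; first exact: open_rset.
rewrite (_ : rset A x = mulset A [set x]).
  apply: precompact_mulset => //.
  by apply: (@sub_compact_precompact _ [set x]) => //; exact: compact_set1.
by apply/seteqP; split=> y; [move=> [a Aa <-]; exists a => //; exists x|
  move=> [a Aa [_ -> <-]]; exists a].
Qed.

Lemma opc_sub A B : open A -> opc B -> A `<=` B -> opc A.
Proof. by move=> oA [_ pB] sAB; split => //; exact: precompact_subset pB. Qed.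

Lemma opcU A B : opc A -> opc B -> opc (A `|` B).
Proof.
move=> [oA pA] [oB pB]; split; first exact: openU.
move: pA pB => [K sAK [cK clK]] [L sBL [cL clL]]; exists (K `|` L).
  by move=> x [/sAK|/sBL]; [left|right].
by split; [exact: compactU|exact: closedU].
Qed.

Lemma opc0 : opc (@set0 G).
Proof.
split; first exact: open0.
by apply: (@sub_compact_precompact _ set0) => //; exact: compact0.
Qed.

Lemma opcI A B : opc A -> opc B -> opc (A `&` B).
Proof.
by move=> opA [oB _]; apply: (opc_sub _ opA) => //; apply: openI => //; case: opA.
Qed.

End OpenPrecompact.

(** * Lower semicontinuous functions and integration *)

Section LowerSemicontinuous.
Context {R : realType} {T : topologicalType}.
Implicit Types f g : T -> R.

Definition lsc f := forall x r, r < f x -> \forall y \near x, r < f y.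

Lemma lsc_open f r : lsc f -> open [set x | r < f x].
Proof. by move=> lf; rewrite openE => x /= rf; exact: lf. Qed.

Lemma lsc_indic (U : set T) : open U -> lsc (\1_U : T -> R).
Proof.
move=> oU x r; rewrite indicE; have [xU|xU] := boolP (x \in U) => /= r1.
  have : nbhs x U by apply: open_nbhs_nbhs; split => //; exact: set_mem.
  by apply: filterS => y Uy; rewrite indicE mem_set.
by apply: filterE => y; rewrite (lt_le_trans r1)// indicE ler0n.
Qed.

Lemma lscM f g : (forall x, 0 <= f x) -> (forall x, 0 <= g x) ->
  lsc f -> lsc g -> lsc (fun x => f x * g x).
Proof.
move=> f0 g0 lf lg x r rfg.
have [r0|r0] := ltP r 0.
  by apply: filterE => y; rewrite (lt_le_trans r0)// mulr_ge0.
have gx : 0 < g x.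
  rewrite lt_neqAle g0 andbT; apply: contraTneq rfg => <-.
  by rewrite mulr0 -leNgt.
have fx : 0 < f x.
  rewrite lt_neqAle f0 andbT; apply: contraTneq rfg => <-.
  by rewrite mul0r -leNgt.
have rf : r / g x < f x by rewrite ltr_pdivrMr.
(* With [s] strictly between [r / g x] and [f x], the bounds [s < f] and [r / s < g] hold near [x]
   and multiply to [r]. *)
pose s := (r / g x + f x) / 2.
have s0 : 0 < s by rewrite /s; have := divr_ge0 r0 (ltW gx); lra.
have /lf : s < f x by rewrite /s; lra.
have /lg : r / s < g x.
  by rewrite ltr_pdivrMr// mulrC -ltr_pdivrMr// /s; lra.
apply: filterS2 => y; rewrite ltr_pdivrMr// => rg sf.
by rewrite (lt_le_trans rg)// mulrC ler_wpM2r// ltW.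
Qed.

End LowerSemicontinuous.

Lemma lsc_comp {R : realType} {S T : topologicalType} (h : S -> T) (f : T -> R) : continuous h -> lsc f ->
  lsc (fun x => f (h x)).
Proof. by move=> ch lf x r /lf; exact: (ch x). Qed.

(** * Real-valued integrals of bounded functions with precompact support *)

Section Integration.
Context {R : realType} {d : measure_display} {G : borelGroupType d}.
Variable mu : {measure set G -> \bar R}.
Hypothesis Hmu : multiplicative_group mu.
Implicit Types (U V A B : set G) (f g : G -> R) (x y : G).

Lemma measurable_open U : open U -> measurable U.
Proof. by move=> oU; rewrite measurable_borel; exact: sub_sigma_algebra. Qed.

Lemma measurable_closed U : closed U -> measurable U.
Proof.
by move=> cU; rewrite -(setCK U); apply: measurableC; apply: measurable_open;
  exact: closed_openC.
Qed.

Lemma opc_lty U : opc U -> (mu U < +oo)%E.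
Proof.
move=> [oU [K sUK [cK clK]]]; have [[r1 _ _] _ _ _ _] := Hmu.
apply: le_lt_trans (r1 _ clK cK); apply: le_measure => //; rewrite inE.
  exact: measurable_open.
exact: measurable_closed.
Qed.

(** An infinite measure becomes 0 under [fine]. Measures are compared only for sets of finite
    measure, where nothing is lost. *)
Definition vol U : R := fine (mu U).

Local Notation m := vol.

Lemma opc_fin U : opc U -> mu U = (m U)%:E.
Proof. by move=> oU; rewrite fineK// ge0_fin_numE//; exact: opc_lty. Qed.

Lemma m_ge0 U : 0 <= m U.
Proof. exact: fine_ge0. Qed.

Lemma m_gt0 U : opc U -> U !=set0 -> 0 < m U.
Proof.
move=> oU U0; rewrite -lte_fin -opc_fin//.
by have [_ _ _ _ h] := Hmu; apply: h => //; case: oU.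
Qed.

Lemma le_m U V : opc U -> opc V -> U `<=` V -> m U <= m V.
Proof.
move=> oU oV sUV; rewrite -lee_fin -!opc_fin//.
by apply: le_measure => //; rewrite inE; apply: measurable_open; [case: oU|case: oV].
Qed.

Lemma m_lset x U : open U -> m (lset x U) = m U.
Proof.
by move=> oU; rewrite /vol; have [_ -> //] := Hmu; exact: measurable_open.
Qed.

Lemma m_rset x U : open U -> m (rset U x) = m U.
Proof.
by move=> oU; rewrite /vol; have [_ _ -> //] := Hmu; exact: measurable_open.
Qed.

Lemma m_invset U : open U -> m (invset U) = m U.
Proof.
by move=> oU; rewrite /vol; have [_ _ _ -> //] := Hmu; exact: measurable_open.
Qed.

Lemma m0 : m set0 = 0.
Proof. by rewrite /vol measure0. Qed.

Definition dominated f := exists M U, opc U /\ forall x, f x <= M * \1_U x.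

(** The class on which [integ] is finite, hence linear and monotone with real values: such an [f] is
    bounded and vanishes outside an open precompact set. *)
Definition tame f :=
  [/\ measurable_fun setT f, forall x, 0 <= f x & dominated f].

Lemma lsc_measurable f : lsc f -> measurable_fun setT f.
Proof.
move=> lf; apply: (measurability _ (RGenOInfty.measurableE R)).
move=> /= _ [_ [a ->]] <-; apply: measurableI => //; apply: measurable_open.
rewrite (_ : _ @^-1` _ = [set x | a < f x]); first exact: lsc_open.
by apply/seteqP; split => x /=; rewrite in_itv/= andbT.
Qed.

Lemma lsc_tame f : lsc f -> (forall x, 0 <= f x) -> dominated f -> tame f.
Proof. by move=> lf f0 df; split => //; exact: lsc_measurable. Qed.

Lemma indic_le1 (S : Type) (A : set S) s : (\1_A s : R) <= 1.
Proof. by rewrite indicE; case: (_ \in _). Qed.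

Lemma indic_ge0 (S : Type) (A : set S) s : 0 <= (\1_A s : R).
Proof. by rewrite indicE ler0n. Qed.

Lemma indicT (S : Type) (A : set S) s : A s -> \1_A s = 1 :> R.
Proof. by move=> As; rewrite indicE mem_set. Qed.

Lemma indicF (S : Type) (A : set S) s : ~ A s -> \1_A s = 0 :> R.
Proof. by move=> As; rewrite indicE memNset. Qed.

Lemma le_indic (S : Type) (A B : set S) s : A `<=` B -> \1_A s <= \1_B s :> R.
Proof.
move=> sAB; have [As|As] := pselect (A s).
  by rewrite !indicT//; exact: sAB.
by rewrite (indicF As) indic_ge0.
Qed.

Lemma tame_dom f : tame f -> exists M U, [/\ 0 <= M, opc U & forall x, f x <= M * \1_U x].
Proof.
move=> [_ _ [M [U [oU h]]]]; exists `|M|, U; split => // x.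
by rewrite (le_trans (h x))// ler_wpM2r ?indic_ge0 ?ler_norm.
Qed.

Lemma tame_indic U : opc U -> tame \1_U.
Proof.
move=> oU; split; last by exists 1, U; split => // x; rewrite mul1r.
  by apply: measurable_indic; apply: measurable_open; case: oU.
exact: indic_ge0.
Qed.

Lemma tame_le f g : measurable_fun setT f -> (forall x, 0 <= f x) ->
  (forall x, f x <= g x) -> tame g -> tame f.
Proof.
move=> mf f0 fg [_ _ [M [U [oU h]]]]; split => //.
by exists M, U; split => // x; exact: le_trans (fg x) (h x).
Qed.

Lemma tameD f g : tame f -> tame g -> tame (fun x => f x + g x).
Proof.
move=> tf tg; have [M [U [M0 oU fM]]] := tame_dom tf.
have [N [V [N0 oV gN]]] := tame_dom tg.
case: tf => mf f0 _; case: tg => mg g0 _; split.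
- exact: measurable_funD.
- by move=> x; rewrite addr_ge0.
exists (M + N), (U `|` V); split; first exact: opcU.
move=> x; rewrite mulrDl; apply: lerD; [apply: le_trans (fM x) _|apply: le_trans (gN x) _].
  by apply: ler_wpM2l => //; apply: le_indic => ?; left.
by apply: ler_wpM2l => //; apply: le_indic => ?; right.
Qed.

Lemma tameZ (c : R) f : 0 <= c -> tame f -> tame (fun x => c * f x).
Proof.
move=> c0 tf; have [M [U [M0 oU fM]]] := tame_dom tf; case: tf => mf f0 _; split.
- exact: measurable_funM.
- by move=> x; rewrite mulr_ge0.
by exists (c * M), U; split => // x; rewrite -mulrA ler_wpM2l.
Qed.

Lemma tameM f g : tame f -> tame g -> tame (fun x => f x * g x).
Proof.
move=> tf tg; have [M [U [M0 oU fM]]] := tame_dom tf.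
have [N [V [N0 oV gN]]] := tame_dom tg.
case: tf => mf f0 _; case: tg => mg g0 _; split.
- exact: measurable_funM.
- by move=> x; rewrite mulr_ge0.
exists (M * N), U; split => // x; rewrite mulrAC ler_pM//.
by rewrite (le_trans (gN x))// ler_piMr// indic_le1.
Qed.

Definition integ f : R := \int[mu]_x f x.

Local Notation I := integ.

Lemma tame_integrable f : tame f -> mu.-integrable setT (EFin \o f).
Proof.
move=> tf; have [M [U [M0 oU fM]]] := tame_dom tf; case: tf => mf f0 _.
have mU : measurable U by apply: measurable_open; case: oU.
apply: (@le_integrable _ _ _ _ _ _ _ (EFin \o (fun x => M * \1_U x))) => //.
- exact/measurable_EFinP.
- by move=> x _ /=; rewrite lee_fin !ger0_norm ?mulr_ge0 ?indic_ge0.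
rewrite (_ : _ \o _ = (fun x => M%:E * (EFin \o \1_U) x)%E); last first.
  by apply/funext => x /=; rewrite EFinM.
apply: integrableZl => //; apply/integrableP; split; first exact/measurable_EFinP.
under eq_integral do rewrite /= ger0_norm ?indic_ge0//.
by rewrite integral_indic// setIT opc_lty.
Qed.

Lemma I_EFin f : tame f -> (\int[mu]_x (f x)%:E)%E = (I f)%:E.
Proof.
move=> tf; rewrite fineK//.
exact: (integrable_fin_num measurableT (tame_integrable tf)).
Qed.

Lemma I_le f g : tame f -> tame g -> (forall x, f x <= g x) -> I f <= I g.
Proof.
by move=> tf tg fg; apply: le_Rintegral => //; exact: tame_integrable.
Qed.

Lemma I_ge0 f : (forall x, 0 <= f x) -> 0 <= I f.
Proof. by move=> f0; exact: Rintegral_ge0. Qed.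

Lemma ID f g : tame f -> tame g -> I (fun x => f x + g x) = I f + I g.
Proof. by move=> tf tg; apply: RintegralD => //; exact: tame_integrable. Qed.

Lemma IZ (c : R) f : tame f -> I (fun x => c * f x) = c * I f.
Proof. by move=> tf; apply: RintegralZl => //; exact: tame_integrable. Qed.

Lemma I_indic U : open U -> I \1_U = m U.
Proof.
move=> oU; rewrite /integ /vol /Rintegral integral_indic// ?setIT//.
exact: measurable_open.
Qed.

Lemma eq_I f g : f =1 g -> I f = I g.
Proof. by move=> /funext ->. Qed.

Lemma integ_eq0 f : (forall x, f x = 0) -> I f = 0.
Proof.
move=> f0; rewrite (@eq_I _ (fun=> 0))// /integ /Rintegral.
by rewrite integral0_eq.
Qed.

(** The pushforward of [mu] along [h] is [mu] itself. Invariance is expressed through images under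
    the inverse [h'] because translates are defined as images. *)
Lemma I_comp (h h' : G -> G) f : cancel h h' -> cancel h' h -> continuous h ->
  (forall A, measurable A -> mu (h' @` A) = mu A) -> tame f ->
  I (fun x => f (h x)) = I f.
Proof.
move=> hK h'K ch muh tf; rewrite /integ /Rintegral; congr fine.
have mh : measurable_fun setT h.
  apply: (measurability _ measurable_borel).
  move=> _ [U oU <-]; rewrite setTI; apply: measurable_open.
  by move/continuousP: ch; exact.
have [mf f0 _] := tf.
rewrite -[LHS](@ge0_integral_pushforward _ _ _ _ _ _ mh mu setT (EFin \o f))//.
- apply: eq_measure_integral => A mA _; rewrite -(muh _ mA) /pushforward.
  congr (mu _); apply/seteqP; split => x /=.
    by move=> Ahx; exists (h x).
  by move=> [y Ay <-]; rewrite h'K.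
- exact/measurable_EFinP.
- by move=> y _; rewrite lee_fin.
Qed.

Lemma I_mulgl x f : tame f -> I (fun y => f (x * y)%g) = I f.
Proof.
apply: (@I_comp _ (fun y => x^-1 * y)%g); first exact: mulKg.
- exact: mulVKg.
- exact: continuous_mulgl.
- by move=> A mA; have [_ h _ _ _] := Hmu; exact: h.
Qed.

End Integration.

(** * Fubini for lower semicontinuous functions *)

Section Fubini.
Context {R : realType} {d : measure_display} {G : borelGroupType d}.
Variable mu : {measure set G -> \bar R}.
Hypothesis Hmu : multiplicative_group mu.
Implicit Types (U V A B : set G) (f g : G -> R) (x y : G).
Local Notation m := (vol mu).
Local Notation I := (integ mu).

(** Inner regularity provides a compact subset of [V] of measure above [s]. Compactness turns the
    local eventual membership in [U j] into eventual inclusion of that whole compact set, with no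
    countability condition on [F]. *)
Lemma measure_lsc (J : Type) (F : set_system J) (V : set G) (U : J -> set G) :
  Filter F -> open V -> (forall j, measurable (U j)) ->
  (forall x, V x -> \forall x' \near x & j \near F, U j x') ->
  forall s, (s < mu V)%E -> \forall j \near F, (s < mu (U j))%E.
Proof.
move=> FF oV mU VU s; have [[_ _ rad] _ _ _ _] := Hmu.
rewrite rad// => /ereal_sup_gt[_ [K [clK cK KV] <-] sK].
move/compact_near_coveringP: cK => cK.
have := cK _ F (fun j x => U j x) FF (fun x Kx => VU x (KV x Kx)).
apply: filterS => j KU; apply: (lt_le_trans sK).
by apply: le_measure => //; rewrite inE//; exact: measurable_closed.
Qed.

(** Together with [staircase_ge], a discrete layer-cake formula: [h] times the number of multiples
    of [h] strictly below [t] approximates [t] from below up to [h]. Integrals are thereby reduced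
    to measures of finitely many superlevel sets. *)
Lemma staircase_le (t h : R) n : 0 < h -> t <= n.+1%:R * h ->
  t <= h + h * \sum_(k < n) (k.+1%:R * h < t)%R%:R.
Proof.
move=> h0; elim: n => [|n IH]; first by rewrite big_ord0 mulr0 addr0 mul1r.
rewrite big_ord_recr/= => tn; have [tn1|tn1] := leP t (n.+1%:R * h).
  by rewrite addr0; exact: IH.
rewrite (le_trans tn)// (eq_bigr (fun=> 1)); last first.
  move=> k _; have -> // : k.+1%:R * h < t.
  rewrite (le_lt_trans _ tn1)// ler_wpM2r ?(ltW h0)// ler_nat.
  by apply: leq_trans (ltn_ord k) _.
by rewrite sumr_const card_ord -!natr1; lra.
Qed.

Lemma staircase_ge (t h : R) n : 0 < h -> 0 <= t ->
  h * \sum_(k < n) (k.+1%:R * h < t)%R%:R <= t.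
Proof.
move=> h0 t0; elim: n => [|n IH]; first by rewrite big_ord0 mulr0.
rewrite big_ord_recr/=; have [tn1|tn1] := leP t (n.+1%:R * h).
  by rewrite addr0.
rewrite (le_trans _ (ltW tn1))// mulrC ler_wpM2r ?(ltW h0)// -natr1 lerD2r.
have : \sum_(k < n) (k.+1%:R * h < t)%R%:R <= \sum_(k < n) (1 : R).
  by apply: ler_sum => k _; case: (_ < _).
by rewrite sumr_const card_ord.
Qed.

Lemma tame_level f r : tame f -> 0 <= r ->
  [/\ measurable [set x | r < f x], (mu [set x | (r < f x)%R] < +oo)%E,
     tame (\1_[set x | r < f x] : G -> R) &
     I \1_[set x | r < f x] = m [set x | r < f x]].
Proof.
move=> tf r0; have [M [U [M0 oU fM]]] := tame_dom tf; have [mf f0 _] := tf.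
have mL : measurable [set x | r < f x].
  rewrite (_ : [set _ | _] = setT `&` f @^-1` `]r, +oo[%classic).
    exact: mf.
  by apply/seteqP; split => x /=; rewrite in_itv/= andbT; [|case].
have mU : measurable U by apply: measurable_open; case: oU.
have sLU : [set x | r < f x] `<=` U.
  move=> x /= rf; apply: contrapT => Ux.
  by have := lt_le_trans rf (fM x); rewrite indicF// mulr0 ltNge r0.
split => //.
- by apply: le_lt_trans (opc_lty Hmu oU); apply: le_measure => //; rewrite inE.
- apply: (tame_le (g := \1_U)); last exact: tame_indic.
  + exact: measurable_indic.
  + by move=> x; exact: indic_ge0.
  + by move=> x; exact: le_indic.
- by rewrite /integ /vol /Rintegral integral_indic// setIT.
Qed.

Lemma tame_sum (J : Type) (s : seq J) (f : J -> G -> R) :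
  (forall j, tame (f j)) -> tame (fun x => \sum_(j <- s) f j x).
Proof.
move=> tf; elim: s => [|j s IH].
  rewrite (_ : (fun _ => _) = fun x => 0 * \1_(set0 : set G) x).
    by apply: tameZ => //; apply: tame_indic; exact: opc0.
  by apply/funext => x; rewrite big_nil mul0r.
rewrite (_ : (fun _ => _) = fun x => f j x + \sum_(j <- s) f j x).
  exact: tameD.
by apply/funext => x; rewrite big_cons.
Qed.

Lemma I_sum (J : Type) (s : seq J) (f : J -> G -> R) :
  (forall j, tame (f j)) -> I (fun x => \sum_(j <- s) f j x) = \sum_(j <- s) I (f j).
Proof.
move=> tf; elim: s => [|j s IH].
  by rewrite big_nil integ_eq0// => x; rewrite big_nil.
rewrite big_cons -IH -ID//; last exact: tame_sum.
by apply: eq_I => x; rewrite big_cons.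
Qed.

(* The integral is lower semicontinuous along arbitrary filters: inner
   regularity by compact sets replaces the countability that Fatou's lemma
   needs. *)
Lemma integral_lsc (J : Type) (F : set_system J) f (g : J -> G -> R) :
  Filter F -> lsc f -> (forall x, 0 <= f x) -> dominated f ->
  (forall j, tame (g j)) ->
  (forall x r, r < f x -> \forall x' \near x & j \near F, r < g j x') ->
  forall s, s < I f -> \forall j \near F, s < I (g j).
Proof.
move=> FF lf f0 df tg fg s sf; have tf : tame f by exact: lsc_tame.
have [M [U [M0 oU fM]]] := tame_dom tf.
(* The discretization error [h * m U] may use one third of the gap [I f - s]; the summand 1 avoids a
   division by zero. *)
pose h := (I f - s) / (3 * (m U + 1)).
have mU0 : 0 <= m U := m_ge0 mu U.
have h0 : 0 < h by rewrite divr_gt0// ?mulr_gt0//; lra.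
have hU : h * m U <= (I f - s) / 3.
  rewrite /h invfM mulrA -[leRHS]mulr1 -mulrA ler_wpM2l//; first by lra.
  by rewrite mulrC ler_pdivrMr; lra.
pose n := Num.bound (M / h).
have nM : M <= n.+1%:R * h.
  rewrite -ler_pdivrMr// (le_trans (ltW (archi_boundP _)))//.
    by rewrite divr_ge0// ltW.
  by rewrite ler_nat.
pose L (k : nat) (f : G -> R) := [set x | k.+1%:R * h < f x].
have kh k : 0 <= k.+1%:R * h by rewrite mulr_ge0// ltW.
have tL k (f' : G -> R) : tame f' -> tame (\1_(L k f') : G -> R).
  by move=> tf'; have [] := tame_level tf' (kh k).
have IL k (f' : G -> R) : tame f' -> I \1_(L k f') = m (L k f').
  by move=> tf'; have [] := tame_level tf' (kh k).
have LE k (f' : G -> R) x : \1_(L k f') x = (k.+1%:R * h < f' x)%R%:R :> R.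
  by rewrite indicE; congr ((_ : bool)%:R); apply/idP/idP; rewrite inE.
have tS (f' : G -> R) : tame f' -> tame (fun x => \sum_(k < n) \1_(L k f') x : R).
    move=> tf'; apply: (@tame_sum _ _ (fun k : 'I_n => \1_(L k f'))) => k.
  exact: tL.
have upper : I f <= h * m U + h * \sum_(k < n) m (L k f).
  under eq_bigr do rewrite -IL//.
  rewrite -I_sum; last by move=> k; exact: tL.
  rewrite -(I_indic mu (proj1 oU)) -!IZ//; [|exact: tS|exact: tame_indic].
  rewrite -ID//; [|by apply: tameZ; [exact: ltW|exact: tame_indic]
    |by apply: tameZ; [exact: ltW|exact: tS]].
  apply: I_le => //.
    by apply: tameD; apply: tameZ; rewrite ?ltW//; [exact: tame_indic|exact: tS].
  move=> x; under eq_bigr do rewrite LE.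
  have [Ux|Ux] := pselect (U x); last first.
    rewrite (le_trans (fM x))// indicF// !mulr0 add0r.
    by apply: mulr_ge0; [exact: ltW|apply: sumr_ge0].
  rewrite indicT// mulr1; apply: staircase_le => //.
  by rewrite (le_trans (fM x))// indicT// mulr1.
have lower j : h * \sum_(k < n) m (L k (g j)) <= I (g j).
  under eq_bigr do rewrite -IL//.
  rewrite -I_sum; last by move=> k; exact: tL.
  rewrite -IZ//; last exact: tS.
  apply: I_le => //; first by apply: tameZ; rewrite ?ltW//; exact: tS.
  move=> x; under eq_bigr do rewrite LE.
  by apply: staircase_ge => //; have [_ + _] := tg j; exact.
(* The loss allowed at each of the [n] levels: the total [h * n * e] uses at most a second third of
   the gap. The successor covers [n = 0]. *)
pose e := (I f - s) / (3 * h * n.+1%:R).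
have e0 : 0 < e.
  by rewrite divr_gt0 ?subr_gt0// mulr_gt0// mulr_gt0.
have fin k (f' : G -> R) : tame f' -> mu (L k f') = (m (L k f'))%:E.
  move=> tf'; have [_ fo _ _] := tame_level tf' (kh k).
  by rewrite fineK// ge0_fin_numE.
have : \forall j \near F, forall k : 'I_n, m (L k f) - e < m (L k (g j)).
  apply: filter_forall => k.
  have /measure_lsc: ((m (L k f) - e)%:E < mu (L k f))%E by rewrite fin// lte_fin; lra.
  move=> /(_ J F (fun j => L k (g j)) FF).
  have oL : open (L k f) by exact: lsc_open.
  move=> /(_ oL) H; apply: filterS (H _ _) => [j|j|x Lx].
  - by rewrite fin// lte_fin.
  - by have [] := tame_level (tg j) (kh k).
  - exact: fg.
apply: filterS => j Hj; apply: lt_le_trans (lower j).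
have : \sum_(k < n) (m (L k f) - e) <= \sum_(k < n) m (L k (g j)).
  by apply: ler_sum => k _; exact: ltW.
rewrite sumrB sumr_const card_ord => S.
have he : h * (e *+ n) <= (I f - s) / 3.
  rewrite /e -mulr_natr; have n0 : 0 < n.+1%:R :> R by [].
  rewrite (_ : h * _ = (I f - s) / 3 * (n%:R / n.+1%:R)); last first.
    by field; rewrite !gt_eqF.
  by rewrite -[leRHS]mulr1 ler_wpM2l// ?ler_pdivrMr ?mul1r ?ler_nat//; lra.
have := ler_wpM2l (ltW h0) S; rewrite mulrBr; lra.
Qed.

(** This is [integral_lsc] along the neighbourhood filter of [t]. *)
Lemma partial_integral_lsc (T : topologicalType) (f : T -> G -> R) :
  lsc (fun p : T * G => f p.1 p.2) -> (forall t x, 0 <= f t x) ->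
  (exists M U, opc U /\ forall t x, f t x <= M * \1_U x) ->
  lsc (fun t => I (f t)).
Proof.
move=> lf f0 [M [U [oU fM]]] t s.
have lft t' : lsc (f t').
  move=> x r rf; have := lf (t', x) r rf.
  case=> -[A B] /= [nA nB] AB; apply: filterS nB => y By.
  by apply: (AB (t', y)); split => //; exact: nbhs_singleton.
have dft t' : dominated (f t') by exists M, U.
apply: integral_lsc => //; first by move=> t'; exact: lsc_tame.
move=> x r rf; have [[A B] /= [nA nB] AB] := lf (t, x) r rf.
exists (B, A) => //= -[y t'] /= [By At'].
exact: (AB (t', y)).
Qed.

Definition dominated2 (f : G -> G -> R) := exists M W, [/\ 0 <= M, opc W &
  forall x y, f x y <= M * (\1_W x * \1_W y)].

Lemma dominated2_sym (f : G -> G -> R) : dominated2 f -> dominated2 (fun x y => f y x).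
Proof.
move=> [M [W [M0 oW H]]]; exists M, W; split => // x y.
by rewrite [X in _ * X]mulrC.
Qed.

Lemma dominated2_section (f : G -> G -> R) x : dominated2 f -> dominated (f x).
Proof.
move=> [M [W [M0 oW H]]]; exists M, W; split => // y.
by rewrite (le_trans (H x y))// ler_wpM2l// ler_piMl ?indic_ge0 ?indic_le1.
Qed.

Lemma dominated2_I (f : G -> G -> R) : (forall x, tame (f x)) -> dominated2 f ->
  dominated (fun x => I (f x)).
Proof.
move=> tf [M [W [M0 oW H]]]; exists (M * m W), W; split => // x.
rewrite -(I_indic mu (proj1 oW)) mulrAC -IZ//; last exact: tame_indic.
apply: I_le => //.
  by apply: tameZ; rewrite ?mulr_ge0 ?indic_ge0//; exact: tame_indic.
by move=> y; rewrite -mulrA.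
Qed.

Lemma lsc_sections (f : G -> G -> R) x :
  lsc (fun p : G * G => f p.1 p.2) -> lsc (f x).
Proof.
move=> lf; apply: (lsc_comp (h := fun y => (x, y)) _ lf) => y.
by apply: cvg_pair; [exact: cvg_cst|exact: cvg_id].
Qed.

Lemma lsc_swap (f : G -> G -> R) :
  lsc (fun p : G * G => f p.1 p.2) -> lsc (fun p : G * G => f p.2 p.1).
Proof.
by move=> lf; apply: (lsc_comp (h := fun p : G * G => (p.2, p.1)) _ lf) => p;
  apply: cvg_pair; [exact: cvg_snd|exact: cvg_fst].
Qed.

(** As [g] vanishes outside [W * W], both iterated integrals are unchanged when [mu] is replaced by
    its restriction to [W]. That restriction is finite, so Tonelli applies although [mu] itself need
    not be sigma-finite. *)
Lemma fubini_measurable (g : G * G -> R) : measurable_fun setT g ->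
  (forall p, 0 <= g p) -> dominated2 (fun x y => g (x, y)) ->
  tame (fun x => I (fun y => g (x, y))) /\
  I (fun x => I (fun y => g (x, y))) = I (fun y => I (fun x => g (x, y))).
Proof.
move=> mg g0 dg; have [M [W [M0 oW gM]]] := dg.
have mW : measurable W by apply: measurable_open; case: oW.
pose nu : {finite_measure set G -> \bar R} := mfrestr mW (opc_lty Hmu oW).
have nuE (f : G -> R) : (forall x, ~ W x -> f x = 0) ->
    (\int[mu]_x (f x)%:E = \int[nu]_x (f x)%:E)%E.
  move=> fW; have fE : (fun x => (f x)%:E) = (fun x => (f x)%:E) \_ W.
    by apply/funext => x; rewrite patchE; case: ifPn => // /negP; rewrite inE => /fW ->.
  rewrite fE -!integral_mkcond; apply: eq_measure_integral => A mA AW.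
  by rewrite /nu/= /mfrestr /mrestr setIidl.
have g1 x y : ~ W x -> g (x, y) = 0.
  move=> Wx; apply/le_anti; rewrite g0 andbT (le_trans (gM x y))//.
  by rewrite indicF// mul0r mulr0.
have g2 x y : ~ W y -> g (x, y) = 0.
  move=> Wy; apply/le_anti; rewrite g0 andbT (le_trans (gM x y))//.
  by rewrite (indicF Wy) !mulr0.
have t1 x : tame (fun y => g (x, y)).
  split => //; last exact: (@dominated2_section (fun x y => g (x, y))).
  exact: (measurableT_comp mg (pair1_measurable x)).
have t2 y : tame (fun x => g (x, y)).
  split => //; last exact/(@dominated2_section (fun y x => g (x, y)))/dominated2_sym.
  exact: (measurableT_comp mg (pair2_measurable y)).
have I1 x : (I (fun y => g (x, y)))%:E = (\int[nu]_y (g (x, y))%:E)%E.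
  by rewrite -nuE ?I_EFin// => y; exact: g2.
have I2 y : (I (fun x => g (x, y)))%:E = (\int[nu]_x (g (x, y))%:E)%E.
  by rewrite -nuE ?I_EFin// => x; exact: g1.
have meg : measurable_fun setT (EFin \o g) by exact/measurable_EFinP.
have g0' p : (0 <= (EFin \o g) p)%E by rewrite lee_fin.
have tI1 : tame (fun x => I (fun y => g (x, y))).
  split; last exact: (@dominated2_I (fun x y => g (x, y))).
    apply/measurable_EFinP; rewrite (_ : _ \o _ = fubini_F nu (EFin \o g)).
      exact: measurable_fun_fubini_tonelli_F.
    by apply/funext => x; rewrite /= I1.
  by move=> x; apply: I_ge0.
split => //; rewrite /integ /Rintegral; congr fine.
have z1 x : ~ W x -> I (fun y => g (x, y)) = 0.
  move=> Wx; apply: integ_eq0 => y; exact: g1.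
have z2 y : ~ W y -> I (fun x => g (x, y)) = 0.
  move=> Wy; apply: integ_eq0 => x; exact: g2.
rewrite !nuE//; under eq_integral do rewrite I1.
under [in RHS]eq_integral do rewrite I2.
exact: (fubini_tonelli (EFin \o g)).
Qed.

Lemma tame_integral (f : G -> G -> R) : lsc (fun p : G * G => f p.1 p.2) ->
  (forall x y, 0 <= f x y) -> dominated2 f ->
  [/\ lsc (fun x => I (f x)), tame (fun x => I (f x)) & forall x, tame (f x)].
Proof.
move=> lf f0 df.
have tf x : tame (f x).
  by apply: lsc_tame => //; [exact: lsc_sections|exact: dominated2_section].
have lI : lsc (fun x => I (f x)).
  apply: partial_integral_lsc => //.
  have [M [W [M0 oW fM]]] := df; exists M, W; split => // x y.
  by rewrite (le_trans (fM x y))// ler_wpM2l// ler_piMl ?indic_ge0 ?indic_le1.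
split => //; apply: lsc_tame => //; first by move=> x; exact: I_ge0.
exact: dominated2_I.
Qed.

(* The product-measurable functions below [f] form an upward directed family
   with supremum [f], so [integral_lsc] applies, first to the inner and then to
   the outer integral. *)
Lemma fubini_lsc_le (f : G -> G -> R) : lsc (fun p : G * G => f p.1 p.2) ->
  (forall x y, 0 <= f x y) -> dominated2 f ->
  I (fun x => I (f x)) <= I (fun y => I (fun x => f x y)).
Proof.
move=> lf f0 df; have [M [W [M0 oW fM]]] := df.
pose C (g : G * G -> R) := [/\ measurable_fun setT g, forall p, 0 <= g p &
  forall p, g p <= f p.1 p.2].
pose J := {g : G * G -> R | C g}.
(* The tails of the directed order on [J]; pointwise maxima make this a filter. *)
pose F : set_system J := [set P | exists g0 : J,
  forall g : J, (forall p, sval g0 p <= sval g p) -> P g].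
have C0 : C (fun=> 0) by split => //=; exact: measurable_cst.
have Cmax (g1 g2 : G * G -> R) : C g1 -> C g2 -> C (fun p => Num.max (g1 p) (g2 p)).
  move=> [m1 p1 l1] [m2 p2 l2]; split.
  - exact: measurable_maxr.
  - by move=> p; rewrite le_max p1.
  - by move=> p; rewrite ge_max l1 l2.
have FF : Filter F.
  split; first by exists (exist _ _ C0).
    move=> P Q [g1 H1] [g2 H2].
    exists (exist _ _ (Cmax _ _ (svalP g1) (svalP g2))) => g /= Hg.
    by split; [apply: H1|apply: H2] => p; apply: le_trans (Hg p); rewrite le_max lexx ?orbT.
  by move=> P Q PQ [g1 H1]; exists g1 => g /H1; exact: PQ.
have dC (g : J) : dominated2 (fun x y => sval g (x, y)).
  exists M, W; split => // x y; have [_ _ /(_ (x, y))/= H] := svalP g.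
  exact: le_trans H (fM x y).
have FC (g : J) := @fubini_measurable (sval g)
   (let: And3 a _ _ := svalP g in a) (let: And3 _ a _ := svalP g in a) (dC g).
have tg (g : J) x : tame (fun y => sval g (x, y)).
  have [mg g0 _] := svalP g; split => //.
    exact: (measurableT_comp mg (pair1_measurable x)).
  exact: (@dominated2_section (fun x y => sval g (x, y))).
have [lI tI tf] := tame_integral lf f0 df.
have [_ tI' tf'] := @tame_integral (fun y x => f x y) (lsc_swap lf) (fun x y => f0 y x) (dominated2_sym df).
(* If the inequality failed, some product-measurable [g <= f] would already have an iterated
   integral above the right-hand side. This contradicts Fubini for [g] followed by monotonicity. *)
rewrite leNgt; apply/negP => lt.
have [] := @integral_lsc J F (fun x => I (f x))
  (fun (g : J) x => I (fun y => sval g (x, y))) FF lI _ _ _ _ _ lt.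
- by case: tI.
- by case: tI.
- by move=> g; have [] := FC g.
- move=> x r rf; apply: (@integral_lsc (G * J)%type (filter_prod (nbhs x) F) (f x)
    (fun (p : G * J) y => sval p.2 (p.1, y))) => //.
  + exact: lsc_sections.
  + exact: dominated2_section.
  move=> y q qf; pose c := Num.max 0 ((q + f x y) / 2).
  have c0 : 0 <= c by rewrite le_max lexx.
  have [q0|q0] := ltP q 0.
    exists (setT, setT); first by split => //=; exact: filterT.
    move=> /= -[y' [x' g]] _ /=; have [_ g0 _] := svalP g.
    exact: lt_le_trans q0 (g0 _).
  have cE : c = (q + f x y) / 2 by apply/max_idPr; lra.
  have cf : c < f x y by lra.
  have [[A B] /= [nA nB] AB] := lf (x, y) c cf.
  have oA : open (interior A) by exact: open_interior.
  have oB : open (interior B) by exact: open_interior.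
  have mi (D : set G) : open D -> measurable_fun setT (\1_D : G -> R).
    by move=> oD; apply: measurable_indic; exact: measurable_open.
  (* Near [(x, y)] the function [f] exceeds [c], which lies strictly between [q] and [f x y]. A
     multiple of the indicator of an open box is therefore a member of the family and witnesses the
     supremum at that point. *)
  have Cg : C (fun p => c * (\1_(interior A) p.1 * \1_(interior B) p.2)).
    split => [|p|p].
    - apply: measurable_funM => //; apply: measurable_funM.
      + exact: (measurableT_comp (mi _ oA) measurable_fst).
      + exact: (measurableT_comp (mi _ oB) measurable_snd).
    - by rewrite !mulr_ge0 ?indic_ge0.
    - have [Ap|Ap] := pselect ((interior A) p.1); last by rewrite (indicF Ap) mul0r mulr0.
      have [Bp|Bp] := pselect ((interior B) p.2); last by rewrite (indicF Bp) !mulr0.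
      rewrite !indicT// !mulr1; apply/ltW/(AB p).
      by split; exact: interior_subset.
  exists ((interior B), (interior A) `*` [set g : J | forall p, sval (exist _ _ Cg) p <= sval g p]).
    split => /=; first exact: nbhs_interior.
    exists ((interior A), [set g : J | forall p, sval (exist _ _ Cg) p <= sval g p]) => //.
    split => /=; first exact: nbhs_interior.
    by exists (exist _ _ Cg).
  move=> /= -[y' [x' g]] /= [By' [Ax' /(_ (x', y')) /= Hg]].
  by apply: lt_le_trans Hg; rewrite !indicT// !mulr1; lra.
move=> g /(_ g (fun=> lexx _)); have [_ ->] := FC g; apply/negP; rewrite -leNgt.
have tg' y : tame (fun x => sval g (x, y)).
  have [mg g0 _] := svalP g; split => //.
    exact: (measurableT_comp mg (pair2_measurable y)).
  exact/(@dominated2_section (fun y x => sval g (x, y)))/dominated2_sym.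
have [_ _ Cgf] := svalP g.
apply: I_le => //; last by move=> y; apply: I_le.
have [mg g0 _] := svalP g.
have ms : measurable_fun setT (fun p : G * G => sval g (p.2, p.1)).
  apply: (measurableT_comp mg); exact: measurable_swap.
have [] // := @fubini_measurable (fun p => sval g (p.2, p.1)) ms.
exact: (dominated2_sym (dC g)).
Qed.

Lemma fubini_lsc (f : G -> G -> R) : lsc (fun p : G * G => f p.1 p.2) ->
  (forall x y, 0 <= f x y) -> dominated2 f ->
  I (fun x => I (f x)) = I (fun y => I (fun x => f x y)).
Proof.
move=> lf f0 df; apply/le_anti; rewrite fubini_lsc_le//=.
apply: (@fubini_lsc_le (fun y x => f x y)) => //.
  exact: lsc_swap.
exact: dominated2_sym.
Qed.

End Fubini.

(** * Convolutions and coverings *)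

Section Convolution.
Context {R : realType} {d : measure_display} {G : borelGroupType d}.
Variable mu : {measure set G -> \bar R}.
Hypothesis Hmu : multiplicative_group mu.
Implicit Types (U V A B : set G) (x y z : G).
Local Notation m := (vol mu).
Local Notation I := (integ mu).

Lemma mU_mI A B : opc A -> opc B -> m (A `|` B) + m (A `&` B) = m A + m B.
Proof.
move=> oA oB; have oU := opcU oA oB; have oI := opcI oA oB.
rewrite -!(I_indic mu); [|exact: (proj1 oB)|exact: (proj1 oA)|exact: (proj1 oI)|exact: (proj1 oU)].
rewrite -!ID//; try exact: tame_indic.
apply: eq_I => x; rewrite !indicE in_setU in_setI.
by case: (x \in A); case: (x \in B) => /=; rewrite ?addr0 ?add0r.
Qed.

Lemma opc_bigU (s : seq G) (D : G -> set G) : (forall y, y \in s -> opc (D y)) ->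
  opc (\big[setU/set0]_(y <- s) D y).
Proof.
elim: s => [|y s IH] oD; first by rewrite big_nil; exact: opc0.
rewrite big_cons; apply: opcU; first by apply: oD; rewrite mem_head.
by apply: IH => z zs; apply: oD; rewrite in_cons zs orbT.
Qed.

Lemma m_cover_le X (s : seq G) (D : G -> set G) : opc X ->
  (forall y, y \in s -> opc (D y)) ->
  m (X `&` \big[setU/set0]_(y <- s) D y) <= \sum_(y <- s) m (X `&` D y).
Proof.
move=> oX; elim: s => [|y s IH] oD; first by rewrite !big_nil setI0 m0.
have oy : opc (D y) by apply: oD; rewrite mem_head.
have os z : z \in s -> opc (D z) by move=> zs; apply: oD; rewrite in_cons zs orbT.
rewrite !big_cons setIUr; apply: le_trans (lerD (lexx _) (IH os)).
by rewrite -mU_mI ?lerDl ?m_ge0//; apply: opcI => //; exact: opc_bigU.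
Qed.

Lemma sum_le_const (T : eqType) (s : seq T) (F : T -> R) c :
  (forall y : T, y \in s -> F y <= c) -> \sum_(y <- s) F y <= (size s)%:R * c.
Proof.
elim: s => [|y s IH] H; first by rewrite big_nil mul0r.
rewrite big_cons /= -natr1 mulrDl mul1r addrC lerD ?H ?mem_head//.
by apply: IH => z zs; apply: H; rewrite in_cons zs orbT.
Qed.

Lemma mem_bigU (T : choiceType) (s : seq T) (D : T -> set G) (z : G) :
  (\big[setU/set0]_(y <- s) D y) z <-> exists2 y : T, y \in s & D y z.
Proof. by rewrite -bigcup_seq; split => [[y ys Dy]|[y ys Dy]]; exists y. Qed.

Lemma pigeonhole X (s : seq G) (D : G -> set G) : opc X -> 0 < m X ->
  (forall y, y \in s -> opc (D y)) ->
  (forall x, X x -> exists2 y, y \in s & D y x) ->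
  exists2 y, y \in s & m X <= (size s)%:R * m (X `&` D y).
Proof.
move=> oX mX oD XD; apply: contrapT => H.
have Hy y : y \in s -> (size s)%:R * m (X `&` D y) < m X.
  by move=> ys; rewrite ltNge; apply/negP => h; apply: H; exists y.
have le1 : m X <= \sum_(y <- s) m (X `&` D y).
  apply: le_trans (m_cover_le oX oD); rewrite le_m//.
    by apply: opcI => //; exact: opc_bigU.
  by move=> x Xx; split => //; apply/mem_bigU; exact: XD.
case: s oD XD H Hy le1 => [|y s] oD XD H Hy.
  by rewrite big_nil leNgt mX.
have n0 : 0 < (size (y :: s))%:R :> R by [].
rewrite big_cons leNgt => /negP; apply.
have F z : z \in y :: s -> m (X `&` D z) < m X / (size (y :: s))%:R.
  by move=> zs; rewrite ltr_pdivlMr// mulrC Hy.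
have S : \sum_(z <- s) m (X `&` D z) <= (size s)%:R * (m X / (size (y :: s))%:R).
  by apply: sum_le_const => z zs; apply/ltW/F; rewrite in_cons zs orbT.
have Fy := F y (mem_head _ _).
apply: (lt_le_trans (ltr_leD Fy S)).
by rewrite -[X in X + _]mul1r -mulrDl nat1r/= mulrC mulfVK// gt_eqF.
Qed.

(* By Bonferroni's inequality, sets of measure at least [mu0] in [Om] with small
   pairwise intersections number at most [2 m(Om) / mu0]; a maximal such family
   covers. *)
Lemma covering (X Om : set G) (D : G -> set G) (mu0 : R) : 0 < mu0 -> opc Om ->
  (forall x, X x -> [/\ opc (D x), D x `<=` Om & mu0 <= m (D x)]) ->
  exists s : seq G, [/\ forall x, x \in s -> X x,
    (size s)%:R <= 2 * (m Om / mu0) &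
    forall x, X x -> exists2 y, y \in s &
      mu0 ^+ 2 / (8 * m Om) < m (D x `&` D y)].
Proof.
move=> mu00 oOm HD.
have [X0|/eqP/set0P[x0 Xx0]] := pselect (X = set0).
  exists [::]; split => //; first by rewrite mulr_ge0// divr_ge0 ?m_ge0// ltW.
  by rewrite X0.
have [oDx0 Dx0 mDx0] := HD _ Xx0.
set k := m Om / mu0; set tau := mu0 ^+ 2 / (8 * m Om).
have mOm : mu0 <= m Om by apply: le_trans mDx0 _; rewrite le_m.
have k1 : 1 <= k by rewrite ler_pdivlMr// mul1r.
have tauE : 4 * k * tau = mu0 / 2.
  rewrite /k /tau; field; rewrite !gt_eqF//; exact: lt_le_trans mOm.
have tau0 : 0 < tau.
  by rewrite divr_gt0 ?exprn_gt0 ?mulr_gt0//; exact: lt_le_trans mOm.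
pose sep (s : seq G) := (forall x, x \in s -> X x) /\
  pairwise (fun x y => m (D x `&` D y) <= tau) s.
(* While there are at most [4 * k] sets, a new one overlaps the earlier ones in measure at most
   [4 * k * tau = mu0 / 2], so it adds at least [mu0 / 2] to the union. *)
have big s : sep s -> (size s)%:R <= 4 * k ->
    (size s)%:R * (mu0 / 2) <= m (\big[setU/set0]_(y <- s) D y).
  elim: s => [|x s IH]; first by rewrite mul0r m_ge0.
  move=> [sX]; rewrite pairwise_cons => /andP[/allP xs ps] sk.
  have sX' y : y \in s -> X y by move=> ys; apply: sX; rewrite in_cons ys orbT.
  have sk' : (size s)%:R <= 4 * k by apply: le_trans sk; rewrite ler_nat.
  have {}IH := IH (conj sX' ps) sk'.
  have [oDx _ mDx] := HD _ (sX _ (mem_head _ _)).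
  have os y : y \in s -> opc (D y) by move=> /sX' /HD[].
  have H1 := m_cover_le oDx os.
  have H2 : m (D x `&` \big[setU/set0]_(y <- s) D y) <= mu0 / 2.
    apply: le_trans H1 _; apply: (le_trans (sum_le_const xs)).
    by rewrite -tauE ler_wpM2r// ltW.
  have := mU_mI oDx (opc_bigU os).
  rewrite big_cons /= -natr1; lra.
have bound s : sep s -> (size s)%:R <= 4 * k -> (size s)%:R <= 2 * k.
  move=> ss s4; have := big s ss s4.
  have : m (\big[setU/set0]_(y <- s) D y) <= m Om.
    apply: le_m => //; first by apply: opc_bigU => y /(proj1 ss)/HD[].
    by move=> z /mem_bigU[y /(proj1 ss)/HD[_ h _]]; exact: h.
  rewrite /k => h1 h2; rewrite mulrA ler_pdivlMr//; lra.
apply: contrapT => H.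
(* A family that does not cover can be extended. As [k >= 1], one set more than [2 * k] is still
   within the range [4 * k] of [big], which brings the size back below [2 * k]; iterating beyond
   that bound is absurd. *)
have ext n : exists s, [/\ sep s, size s = n & (size s)%:R <= 2 * k].
  elim: n => [|n [s [ss sn sk]]].
    by exists [::]; split => //=; lra.
  have [x [Xx nx]] : exists x, X x /\ forall y, y \in s -> m (D x `&` D y) <= tau.
    apply: contrapT => H'; apply: H; exists s; split => //; first exact: (proj1 ss).
    move=> x Xx; apply: contrapT => H2; apply: H'; exists x; split => // y ys.
    by rewrite leNgt; apply/negP => h; apply: H2; exists y.
  have sx : sep (x :: s).
    split; first by move=> y; rewrite in_cons => /predU1P[->//|]; exact: (proj1 ss).
    by rewrite pairwise_cons (proj2 ss) andbT; apply/allP.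
  exists (x :: s); split => //=; first by rewrite sn.
  by apply: (bound _ sx); rewrite /= -natr1; lra.
have [s [_ sn]] := ext (Num.bound (2 * k)).
by rewrite sn leNgt archi_boundP// mulr_ge0//; lra.
Qed.

(** The convolution of the two indicators at [z], written as the measure of the set of [y] in [U]
    with [y^-1 z] in [V]: the amount of factorizations of [z] in [U V]. *)
Definition conv U V z := m (U `&` lset z (invset V)).

Lemma mem_lset_inv V y z : lset z (invset V) y <-> V (y^-1 * z)%g.
Proof. by rewrite lsetE invsetE /= invgM invgK. Qed.

(** For fixed [x], left invariance replaces the second variable by [x^-1 z]; exchanging the
    integrals then makes the product [z] the outer variable. *)
Lemma I_shear (F : G -> G -> R) : lsc (fun p : G * G => F p.1 p.2) ->
  (forall x y, 0 <= F x y) -> dominated2 F ->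
  [/\ forall z, tame (fun x => F x (x^-1 * z)%g),
     lsc (fun z => I (fun x => F x (x^-1 * z)%g)),
     tame (fun z => I (fun x => F x (x^-1 * z)%g)) &
     I (fun x => I (F x)) = I (fun z => I (fun x => F x (x^-1 * z)%g))].
Proof.
move=> lF F0 dF; have [M [W [M0 oW FM]]] := dF.
pose F' x z := F x (x^-1 * z)%g.
have lF' : lsc (fun p : G * G => F' p.1 p.2).
  apply: (lsc_comp (h := fun p : G * G => (p.1, p.1^-1 * p.2)%g) _ lF) => p.
  apply: cvg_pair; first exact: cvg_fst.
  apply: (@continuous_mulg _ _ (fun p : G * G => p.1^-1)%g (fun p : G * G => p.2)).
    by apply: continuous_invg => q; exact: cvg_fst.
  by move=> q; exact: cvg_snd.
have dF' : dominated2 F'.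
  exists M, (W `|` mulset W W); split => //; first exact/opcU/opc_mulset.
  move=> x z; apply: (le_trans (FM _ _)); rewrite ler_wpM2l//.
  have [Wx|Wx] := pselect (W x); last by rewrite indicF// mul0r mulr_ge0 ?indic_ge0.
  have [Wz|Wz] := pselect (W (x^-1 * z)%g); last first.
    by rewrite (indicF Wz) mulr0 mulr_ge0 ?indic_ge0.
  rewrite !indicT ?mulr1//; [right|by left].
  by exists x => //; exists (x^-1 * z)%g; rewrite ?mulVKg.
have [_ _ tF] := tame_integral Hmu lF F0 dF.
have F'0 x z : 0 <= F' x z by exact: F0.
have [l1 t1 t1'] := @tame_integral _ _ _ _ Hmu (fun z x => F' x z) (lsc_swap lF')
  (fun z x => F'0 x z) (dominated2_sym dF').
split; [exact: t1'|exact: l1|exact: t1|].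
rewrite -(fubini_lsc Hmu lF' F'0 dF'); apply: eq_I => x.
by rewrite (I_mulgl Hmu _ (tF x)).
Qed.

Lemma convE U V z : opc U -> opc V ->
  conv U V z = I (fun x => \1_U x * \1_V (x^-1 * z)%g).
Proof.
move=> oU oV; rewrite /conv -(I_indic mu); last first.
  by apply: openI; [case: oU|apply: open_lset; apply: open_invset; case: oV].
apply: eq_I => x; have [Ux|Ux] := pselect (U x); last first.
  by rewrite (indicF Ux) mul0r indicF => // -[].
rewrite (indicT Ux) mul1r; have [Vx|Vx] := pselect (V (x^-1 * z)%g).
  by rewrite (indicT Vx) indicT => //; split => //; apply/mem_lset_inv.
by rewrite (indicF Vx) indicF => // -[_ /mem_lset_inv].
Qed.

Lemma I_indicM U V : opc U -> opc V ->
  I (fun x => I (fun y => \1_U x * \1_V y)) = m U * m V.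
Proof.
move=> oU oV.
under eq_I do rewrite (IZ Hmu _ (tame_indic oV)) (I_indic mu (proj1 oV)) mulrC.
by rewrite (IZ Hmu _ (tame_indic oU)) (I_indic mu (proj1 oU)) mulrC.
Qed.

Lemma lsc_indicM U V : open U -> open V ->
  lsc (fun p : G * G => \1_U p.1 * \1_V p.2 : R).
Proof.
move=> oU oV.
apply: lscM; [by move=> p; exact: indic_ge0|by move=> p; exact: indic_ge0| |].
  by apply: (lsc_comp (h := fst)); [exact: continuous_fst|exact: lsc_indic].
by apply: (lsc_comp (h := snd)); [exact: continuous_snd|exact: lsc_indic].
Qed.

Lemma dominated2_indicM U V : opc U -> opc V ->
  dominated2 (fun x y => \1_U x * \1_V y : R).
Proof.
move=> oU oV; exists 1, (U `|` V); split; [exact: ler01|exact: opcU|].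
move=> x y; rewrite mul1r; apply: ler_pM; [exact: indic_ge0|exact: indic_ge0|..].
  by apply: le_indic => ?; left.
by apply: le_indic => ?; right.
Qed.

Lemma conv_props U V : opc U -> opc V ->
  [/\ lsc (conv U V), tame (conv U V) & I (conv U V) = m U * m V].
Proof.
move=> oU oV; rewrite -(I_indicM oU oV).
rewrite (_ : conv U V = fun z => I (fun x => \1_U x * \1_V (x^-1 * z)%g)).
  have := I_shear (lsc_indicM (proj1 oU) (proj1 oV))
    (fun x y => mulr_ge0 (indic_ge0 U x) (indic_ge0 V y)) (dominated2_indicM oU oV).
  by case=> _ l t e; split; [exact: l|exact: t|rewrite e].
by apply/funext => z; exact: convE.
Qed.

Lemma opc_conv U V z : opc U -> opc V -> opc (U `&` lset z (invset V)).
Proof. by move=> oU oV; apply: opcI => //; apply: opc_lset; exact: opc_invset. Qed.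

(** The translate [t Q] parametrizes factorizations [z = (t y) ((t y)^-1 z)]. All lower bounds for
    numbers of representations are obtained in this form. *)
Lemma conv_ge U V Q z t : opc U -> opc V -> opc Q ->
  (forall y, Q y -> U (t * y)%g /\ V ((t * y)^-1 * z)%g) -> m Q <= conv U V z.
Proof.
move=> oU oV oQ H; rewrite -(m_lset Hmu t (proj1 oQ)); apply: le_m => //.
- exact: opc_lset.
- exact: opc_conv.
- by move=> _ [y Qy <-]; have [? ?] := H y Qy; split => //; apply/mem_lset_inv.
Qed.

Lemma conv_le U V z : opc U -> opc V -> conv U V z <= m U /\ conv U V z <= m V.
Proof.
move=> oU oV; split; first by apply: le_m => //; exact: opc_conv.
rewrite -(m_invset Hmu (proj1 oV)) -(m_lset Hmu z (open_invset (proj1 oV))).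
by apply: le_m => //; [exact: opc_conv|exact/opc_lset/opc_invset].
Qed.

(** Markov's inequality, the total mass of the convolution being [m U * m V]: a set whose elements
    all have many representations is small. *)
Lemma markov_conv U V D c : opc U -> opc V -> opc D -> 0 <= c ->
  (forall z, D z -> c <= conv U V z) -> c * m D <= m U * m V.
Proof.
move=> oU oV oD c0 H; have [_ t <-] := conv_props oU oV.
rewrite -(I_indic mu (proj1 oD)) -IZ//; last exact: tame_indic.
apply: I_le => //; first by apply: tameZ => //; exact: tame_indic.
move=> z; have [Dz|Dz] := pselect (D z); first by rewrite indicT// mulr1 H.
by rewrite indicF// mulr0 m_ge0.
Qed.

(** The [g] for which [U] and [g U] meet in measure more than [c], that is, the quotients [u u'^-1]
    with many representations. The strict inequality makes this an open set. *)
Definition popular U c := [set g | c < conv U (invset U) g].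

Lemma popular_sub U c : 0 <= c -> popular U c `<=` mulset U (invset U).
Proof.
move=> c0 g; rewrite /popular /= => cg; apply: contrapT => H.
move: cg; rewrite /conv (_ : _ `&` _ = set0) ?m0 ?ltNge ?c0//.
apply/seteqP; split => // y [Uy /mem_lset_inv Uyg]; apply: H.
by exists y => //; exists (y^-1 * g)%g; rewrite ?mulVKg.
Qed.

Lemma opc_popular U c : opc U -> 0 <= c -> opc (popular U c).
Proof.
move=> oU c0; have oU' := opc_invset oU.
apply: opc_sub (popular_sub c0); last exact: opc_mulset.
by apply: lsc_open; have [] := conv_props oU oU'.
Qed.

Lemma m_popular U c : opc U -> 0 <= c -> c * m (popular U c) <= m U ^+ 2.
Proof.
move=> oU c0; have oU' := opc_invset oU.
rewrite expr2 -{2}(m_invset Hmu (proj1 oU)); apply: markov_conv => //.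
  exact: opc_popular.
by move=> z; exact: ltW.
Qed.

Lemma popular_inv U c g : opc U -> popular U c g -> popular U c (g^-1)%g.
Proof.
move=> oU; rewrite /popular /= => /lt_le_trans; apply.
have oU' := opc_invset oU.
apply: (@conv_ge _ _ _ _ (g^-1)%g) => //; first exact: opc_conv.
move=> y [Uy /mem_lset_inv]; rewrite invsetE /= invgM invgK => Ugy; split => //.
by rewrite invgM !invgK mulVKg.
Qed.

Lemma invset_popular U c : opc U -> invset (popular U c) = popular U c.
Proof.
move=> oU; rewrite invsetE; apply/seteqP; split => g /=.
  by move=> /(popular_inv oU); rewrite invgK.
exact: popular_inv.
Qed.

End Convolution.

(** * From small quotient sets to approximate groups *)

Section ApproximateGroups.
Context {R : realType} {d : measure_display} {G : borelGroupType d}.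
Variable mu : {measure set G -> \bar R}.
Hypothesis Hmu : multiplicative_group mu.
Implicit Types (U V W A B S : set G) (x y z : G).
Local Notation m := (vol mu).
Local Notation I := (integ mu).

(** This is [W S^n]; in particular [mulpow S S n] is the power of [S] with exponent [n + 1]. *)
Definition mulpow W S n := iter n (fun V => mulset V S) W.

Lemma opc_mulpow W S n : opc W -> opc S -> opc (mulpow W S n).
Proof. by move=> oW oS; elim: n => //= n IH; exact: opc_mulset. Qed.

Lemma mulset_mulpow A W S n : mulset A (mulpow W S n) = mulpow (mulset A W) S n.
Proof. by elim: n => //= n IH; rewrite mulsetA IH. Qed.

(* An element [x] of the popular set has many factorizations [y * (y^-1 * x)] with
   [y] in [A^-1] and [y^-1 * x] in [A], so [w x c^-1] is the product of
   [w y] and [y^-1 x c^-1] in many ways. *)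
Lemma mulpow_growth A W (tau : R) : opc A -> opc W -> 0 <= tau ->
  tau * m (mulset (mulset W (popular mu (invset A) tau)) (invset A)) <=
  m (mulset W (invset A)) * m (mulset A (invset A)).
Proof.
move=> oA oW tau0; have oA' := opc_invset oA.
have oS := opc_popular Hmu oA' tau0.
apply: (markov_conv Hmu) => //; do 1?[by do ?apply: opc_mulset].
move=> _ [_ [w Ww [x Sx <-]] [c Ac <-]]; apply: le_trans (ltW Sx) _.
rewrite /conv; apply: (conv_ge Hmu (t := w)); do 1?[by do ?apply: opc_mulset].
  by apply: opc_conv => //; exact: opc_invset.
move=> y [Ay /mem_lset_inv]; rewrite invsetK => Ayx; split.
  exact: mem_mulset.
rewrite (_ : _ * _ = y^-1 * x * c)%g; first exact: mem_mulset.
by rewrite invgM !mulgA -(mulgA _ w^-1%g) mulVg mulg1.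
Qed.

(** The translates [x A^-1] with [x] in [A] all lie in [A A^-1], so [covering] finds at most [2 * k]
    centres [y] such that each [x A^-1] overlaps some [y A^-1] substantially. That overlap makes
    [y^-1 x] a popular quotient of [A^-1], so the translates [y S] cover [A] and one of them takes a
    large share. The growth of the powers of [S] comes from [mulpow_growth]. *)
Lemma small_quotient A (k : R) : opc A -> 0 < m A ->
  m (mulset A (invset A)) <= k * m A ->
  exists S, [/\ opc S, invset S = S, S `<=` mulset (invset A) A,
    exists2 x, A x & m A <= 2 * k * m (A `&` lset x S) &
    forall n, m (mulpow S S n) <= (8 * k ^+ 2) ^+ n.+1 * (k * m A)].
Proof.
move=> oA mA Ak; have oA' := opc_invset oA.
have oAA := opc_mulset oA oA'.
have [a Aa] : A !=set0.
  by apply/set0P; apply/eqP => A0; rewrite A0 m0 ltxx in mA.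
have AO : m A <= m (mulset A (invset A)).
  rewrite -(m_rset Hmu (a^-1)%g (proj1 oA)); apply: le_m => //; first exact: opc_rset.
  by move=> _ [b Ab <-]; apply: mem_mulset => //; exact: mem_invset.
have k1 : 1 <= k by rewrite -(ler_pM2r mA) mul1r (le_trans _ Ak).
(* At most the overlap [m A ^ 2 / (8 m (A A^-1))] guaranteed by [covering], as
   [m (A A^-1) <= k * m A]. *)
pose tau := m A / (8 * k); have tau0 : 0 < tau by rewrite divr_gt0 ?mulr_gt0//; lra.
pose S := popular mu (invset A) tau.
have oS : opc S by apply: opc_popular => //; exact: ltW.
have growth W : opc W ->
    m (mulset (mulset W S) (invset A)) <= 8 * k ^+ 2 * m (mulset W (invset A)).
  move=> oW; have := mulpow_growth oA oW (ltW tau0); rewrite -/S.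
  move=> /le_trans => /(_ _ (ler_wpM2l (m_ge0 mu _) Ak)).
  rewrite -ler_pdivlMl// => /le_trans; apply.
  rewrite /tau le_eqVlt; apply/orP; left; apply/eqP.
  by field; rewrite !gt_eqF//; lra.
exists S; split => //.
- exact: invset_popular.
- by rewrite -{2}(invsetK A); apply: popular_sub; exact: ltW.
- have [|s [sA sk cov]] := @covering _ _ _ _ Hmu A (mulset A (invset A))
    (fun x => lset x (invset A)) (m A) mA oAA.
    move=> x Ax; split; first exact: opc_lset.
      by move=> _ [b Ab <-]; exact: mem_mulset.
    by rewrite m_lset ?m_invset//; [exact: (proj1 oA)|exact: (proj1 oA')].
  have [||y ys Hy] := @pigeonhole _ _ _ _ Hmu A s (fun y => lset y S) oA mA.
  + by move=> y _; exact: opc_lset.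
  + move=> x Ax; have [y ys Hy] := cov x Ax; exists y => //.
    rewrite lsetE /=; apply: le_lt_trans (lt_le_trans Hy _).
      rewrite /tau ler_pdivlMr ?mulr_gt0//; last exact: lt_le_trans AO.
      rewrite mulrAC ler_pdivrMr ?mulr_gt0//; last by lra.
      by have := ler_wpM2l (ltW mA) Ak; rewrite expr2; lra.
    apply: (conv_ge Hmu (t := y^-1)%g) => //.
    * exact: opc_invset.
    * by apply: opcI; exact: opc_lset.
    move=> w []; rewrite !lsetE !invsetE /= !invgM !invgK => Awx Awy; split => //.
    by rewrite mulgA mulgK.
  exists y; first exact: sA.
  apply: le_trans Hy _; rewrite ler_wpM2r ?m_ge0// (le_trans sk)//.
  by rewrite ler_pM2l// ler_pdivrMr.
move=> n; have oP : opc (mulpow S S n) by exact: opc_mulpow.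
(* The conjugate [a S^(n+1) a^-1] lies in [A S^(n+1) A^-1], and each factor [S] there costs
   [m (A A^-1) / tau <= 8 k^2]. *)
apply: (@le_trans _ _ (m (mulset (mulpow (mulset A S) S n) (invset A)))).
  rewrite -(m_lset Hmu a (proj1 oP)) -(m_rset Hmu (a^-1)%g (open_lset a (proj1 oP))).
  apply: le_m => //; first by apply: opc_rset; exact: opc_lset.
    by apply: opc_mulset => //; apply: opc_mulpow => //; exact: opc_mulset.
  move=> _ [_ [p Pp <-] <-]; rewrite -mulset_mulpow.
  by apply: mem_mulset; [exact: mem_mulset|exact: mem_invset].
have k80 : 0 <= 8 * k ^+ 2 by rewrite mulr_ge0// sqr_ge0.
elim: n {oP} => [|n IH].
  by rewrite expr1 (le_trans (growth _ oA))// ler_wpM2l.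
rewrite exprS -mulrA; apply: le_trans (ler_wpM2l k80 IH).
by apply: growth; apply: opc_mulpow => //; exact: opc_mulset.
Qed.

(** Ruzsa covering: the translates [x S] with [x] in [S^4] lie in [S^5], so at most [2 * q] of them
    meet all the others. If [x S] meets [y S], then [y^-1 x] lies in [S S^-1 = S S]. Adding the
    inverses of the centres makes [X] symmetric and doubles the bound to [4 * q]. *)
Lemma approximate_group_sqr S (q : R) : opc S -> S !=set0 -> invset S = S ->
  m (mulpow S S 4) <= q * m S -> approximate_group (4 * q) (mulset S S).
Proof.
move=> oS S0 Sinv Sq; have mS := m_gt0 Hmu oS S0.
have oS4 : opc (mulpow S S 4) by exact: opc_mulpow.
have HH : mulset (mulset S S) (mulset S S) = mulpow S S 3 by rewrite !mulsetA.
have Hinv : invset (mulset S S) = mulset S S by rewrite invset_mulset Sinv.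
split => //.
  have [s Ss] := S0; have [? ?] := opc_mulset oS oS.
  by split => //; exists (s * s)%g; exact: mem_mulset.
have [|s [sX sk cov]] := @covering _ _ _ _ Hmu (mulpow S S 3) (mulpow S S 4)
    (fun x => lset x S) (m S) mS oS4.
  move=> x Sx; split; first exact: opc_lset.
    by move=> _ [b Ab <-]; exact: mem_mulset.
  by rewrite m_lset//; exact: (proj1 oS).
pose t := s ++ [seq (x^-1)%g | x <- s].
have tE x : x \in t <-> x \in s \/ (x^-1)%g \in s.
  rewrite mem_cat; split => [/orP[|/mapP[y ys ->]]|[->//|xs]]; [by left|..].
    by right; rewrite invgK.
  by apply/orP; right; apply/mapP; exists (x^-1)%g => //; rewrite invgK.
pose X := seq_fset tt t.
have XE x : [set` X] x <-> x \in s \/ (x^-1)%g \in s.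
  split=> [xX|xs]; first by apply/tE; rewrite -(seq_fsetE tt); exact: xX.
  by rewrite /mkset seq_fsetE; apply/tE.
exists X; split.
- rewrite invsetE; apply/seteqP; split => x; rewrite [X in X _ -> _]/=.
    by move=> /XE; rewrite invgK => -[h|h]; apply/XE; [right|left].
  by move=> /XE [h|h]; apply/XE; rewrite ?invgK; [right|left].
- move=> x /XE [/sX|/sX]; rewrite ?HH// => S3.
  have inv3 : invset (mulpow S S 3) = mulpow S S 3 by rewrite -HH invset_mulset Hinv.
  by rewrite -inv3 invsetE.
- rewrite (@le_trans _ _ (size t)%:R)//.
    by rewrite ler_nat size_seq_fset size_undup.
  rewrite size_cat size_map natrD; move: sk.
  have : m (mulpow S S 4) / m S <= q by rewrite ler_pdivrMr.
  lra.
- rewrite HH => x Sx; have [y ys Hy] := cov x Sx.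
  have [z [Sxz Syz]] : lset x S `&` lset y S !=set0.
    apply/set0P/eqP => e; move: Hy; rewrite e m0 ltNge => /negP; apply.
    by rewrite divr_ge0 ?sqr_ge0// mulr_ge0// m_ge0.
  rewrite -(mulVKg y x); apply: mem_mulset; first by apply/XE; left.
  move: Sxz Syz; rewrite !lsetE /= => Sxz Syz.
  rewrite -{2}Sinv (_ : _ * _ = (y^-1 * z) * (x^-1 * z)^-1)%g.
    by apply: mem_mulset => //; exact: mem_invset.
  by rewrite invgM invgK mulgA mulgK.
Qed.

End ApproximateGroups.

(** * The Balog-Szemeredi-Gowers theorem *)

Section Sections.
Context {R : realType} {d : measure_display} {G : borelGroupType d}.
Variable mu : {measure set G -> \bar R}.
Hypothesis Hmu : multiplicative_group mu.
Implicit Types (U V W A B P : set G) (x y z : G) (E : set (G * G)).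
Local Notation m := (vol mu).
Local Notation I := (integ mu).

Definition row E x := [set y | E (x, y)].
Definition col E y := [set x | E (x, y)].

Lemma opc_row E A B x : open E -> E `<=` A `*` B -> opc B -> opc (row E x).
Proof.
move=> oE sE oB; apply: opc_sub oB _; last by move=> y /sE[].
apply: (@open_preimage _ _ (fun y => (x, y))) oE => y.
by apply: cvg_pair; [exact: cvg_cst|exact: cvg_id].
Qed.

Lemma opc_col E A B y : open E -> E `<=` A `*` B -> opc A -> opc (col E y).
Proof.
move=> oE sE oA; apply: opc_sub oA _; last by move=> x /sE[].
apply: (@open_preimage _ _ (fun x => (x, y))) oE => x.
by apply: cvg_pair; [exact: cvg_id|exact: cvg_cst].
Qed.

Lemma indic_row E x y : \1_E (x, y) = \1_(row E x) y :> R.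
Proof. by rewrite !indicE; congr (_%:R); apply/idP/idP; rewrite !inE. Qed.

Lemma indic_col E x y : \1_E (x, y) = \1_(col E y) x :> R.
Proof. by rewrite !indicE; congr (_%:R); apply/idP/idP; rewrite !inE. Qed.

Lemma dominated2_indic E A B : opc A -> opc B -> E `<=` A `*` B ->
  dominated2 (fun x y => \1_E (x, y) : R).
Proof.
move=> oA oB sE; exists 1, (A `|` B); split; [exact: ler01|exact: opcU|].
move=> x y; rewrite mul1r; have [Exy|Exy] := pselect (E (x, y)).
  have [Ax By] := sE _ Exy; rewrite !indicT ?mul1r//.
    by right.
  by left.
by rewrite (indicF Exy); apply: mulr_ge0; exact: indic_ge0.
Qed.

Lemma sections E A B : open E -> opc A -> opc B -> E `<=` A `*` B ->
  [/\ lsc (fun x => m (row E x)), tame (fun x => m (row E x)),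
     lsc (fun y => m (col E y)), tame (fun y => m (col E y)) &
     I (fun x => m (row E x)) = I (fun y => m (col E y))].
Proof.
move=> oE oA oB sE.
have lE : lsc (fun p : G * G => \1_E (p.1, p.2) : R).
  rewrite (_ : (fun p => _) = \1_E); first exact: lsc_indic.
  by apply/funext => -[].
have E0 x y : 0 <= \1_E (x, y) :> R by exact: indic_ge0.
have dE := dominated2_indic oA oB sE.
pose e := (fun x y => \1_E (x, y) : R).
have [l1 t1 _] := @tame_integral _ _ _ _ Hmu e lE E0 dE.
have [l2 t2 _] := @tame_integral _ _ _ _ Hmu (fun y x => e x y) (@lsc_swap _ _ _ e lE)
  (fun y x => E0 x y) (dominated2_sym dE).
have eE := @fubini_lsc _ _ _ _ Hmu e lE E0 dE.
have rE : (fun x => I (fun y => \1_E (x, y))) = (fun x => m (row E x)).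
  apply/funext => x; rewrite -(I_indic mu (proj1 (opc_row x oE sE oB))).
  by apply: eq_I => y; exact: indic_row.
have cE : (fun y => I (fun x => \1_E (x, y))) = (fun y => m (col E y)).
  apply/funext => y; rewrite -(I_indic mu (proj1 (opc_col y oE sE oA))).
  by apply: eq_I => x; exact: indic_col.
by rewrite /e rE in l1 t1 eE; rewrite /e cE in l2 t2 eE.
Qed.

(** The variable [y] moves from the outermost to the innermost place by two exchanges, with [x]
    after integrating out [x'], then with [x'] for fixed [x]. Tameness of the intermediate integrals
    is recorded because monotonicity and linearity of [I] ask for it. *)
Lemma fubini3 (h : G -> G -> G -> R) W : opc W ->
  lsc (fun p : G * G * G => h p.1.1 p.1.2 p.2) -> (forall x x' y, 0 <= h x x' y) ->
  (forall x x' y, h x x' y <= \1_W x * \1_W x' * \1_W y) ->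
  [/\ forall y, lsc (fun x => I (fun x' => h x x' y)) /\
        tame (fun x => I (fun x' => h x x' y)),
      tame (fun y => I (fun x => I (fun x' => h x x' y))),
      (forall x, tame (fun x' => I (fun y => h x x' y))) /\
      (forall x x', tame (h x x')),
      tame (fun x => I (fun x' => I (fun y => h x x' y))) &
      I (fun y => I (fun x => I (fun x' => h x x' y))) =
      I (fun x => I (fun x' => I (fun y => h x x' y)))].
Proof.
move=> oW lh h0 hW.
have h2 x x' y : h x x' y <= 1 * (\1_W x' * \1_W y).
  apply: (le_trans (hW x x' y)); rewrite mul1r -mulrA.
  by apply: ler_piMl; [apply: mulr_ge0; exact: indic_ge0|exact: indic_le1].
have m10 : m W >= 0 := m_ge0 mu W.
have lhxy : lsc (fun p : G * G => I (fun x' => h p.1 x' p.2)).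
  apply: (@partial_integral_lsc _ _ _ _ Hmu _ (fun (p : G * G) x' => h p.1 x' p.2)).
  - apply: (lsc_comp (h := fun p : G * G * G => ((p.1.1, p.2), p.1.2)) _ lh).
    apply: continuous_pair; last first.
      move=> p; apply: (@continuous_comp _ _ _ (@fst (G * G)%type G) (@snd G G)).
        exact: continuous_fst.
      exact: continuous_snd.
    apply: continuous_pair; last exact: continuous_snd.
    move=> p; apply: (@continuous_comp _ _ _ (@fst (G * G)%type G) (@fst G G)).
      exact: continuous_fst.
    exact: continuous_fst.
  - by move=> p x'; exact: h0.
  - exists 1, W; split; first exact: oW.
    move=> p x'; apply: (le_trans (h2 _ _ _)); rewrite mul1r mul1r.
    by apply: ler_piMr; [exact: indic_ge0|exact: indic_le1].
have lhxx : lsc (fun p : G * G => I (fun y => h p.1 p.2 y)).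
  apply: (@partial_integral_lsc _ _ _ _ Hmu _ (fun (p : G * G) y => h p.1 p.2 y)).
  - exact: lh.
  - by move=> p y; exact: h0.
  - exists 1, W; split; first exact: oW.
    move=> p x'; apply: (le_trans (h2 _ _ _)); rewrite mul1r mul1r.
    by apply: ler_piMl; [exact: indic_ge0|exact: indic_le1].
have lx x : lsc (fun p : G * G => h x p.1 p.2).
  apply: (lsc_comp (h := fun p : G * G => ((x, p.1), p.2)) _ lh).
  apply: continuous_pair; last exact: continuous_snd.
  by apply: continuous_pair; [move=> p; exact: cvg_cst|exact: continuous_fst].
have dx x : dominated2 (h x) by exists 1, W; split; [exact: ler01|exact: oW|exact: h2].
have txx x x' : tame (h x x').
  by have [_ _] := tame_integral Hmu (lx x) (h0 x) (dx x); exact.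
have dI (k : G -> G -> G -> R) : (forall x y, tame (k x y)) ->
    (forall x y z, k x y z <= \1_W x * \1_W y * \1_W z) ->
    dominated2 (fun x y => I (k x y)).
  move=> tk kW; exists (m W), W; split; [exact: m10|exact: oW|] => x y.
  rewrite mulrC -(I_indic mu (proj1 oW)) -(IZ Hmu _ (tame_indic oW)).
  apply: (I_le Hmu (tk x y)); last exact: kW.
  by apply: tameZ; [apply: mulr_ge0; exact: indic_ge0|exact: tame_indic].
have txy x y : tame (fun x' => h x x' y).
  have [_ _ t] := @tame_integral _ _ _ _ Hmu (fun y x' => h x x' y)
    (lsc_swap (lx x)) (fun y x' => h0 x x' y) (dominated2_sym (dx x)).
  exact: (t y).
have dxy : dominated2 (fun x y => I (fun x' => h x x' y)).
  apply: (dI (fun x y x' => h x x' y)) => [x y|x y x']; first exact: txy.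
  by apply: (le_trans (hW _ _ _)); rewrite mulrAC.
have dxx : dominated2 (fun x x' => I (h x x')) by apply: dI; [exact: txx|exact: hW].
have pxy x y : 0 <= I (fun x' => h x x' y) by apply: I_ge0 => x'; exact: h0.
have pxx x x' : 0 <= I (h x x') by apply: I_ge0 => y; exact: h0.
have [l1 t1 s1] := @tame_integral _ _ _ _ Hmu (fun y x => I (fun x' => h x x' y))
   (lsc_swap (f := fun x y => I (fun x' => h x x' y)) lhxy)
   (fun y x => pxy x y) (dominated2_sym dxy).
have [l2 t2 s2] := @tame_integral _ _ _ _ Hmu (fun x x' => I (h x x')) lhxx pxx dxx.
split.
- move=> y; split; last exact: s1.
  apply: (lsc_comp (h := fun x => (x, y)) _ lhxy) => x.
  by apply: cvg_pair; [exact: cvg_id|exact: cvg_cst].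
- exact: t1.
- by split; [exact: s2|exact: txx].
- exact: t2.
rewrite -(@fubini_lsc _ _ _ _ Hmu (fun x y => I (fun x' => h x x' y)) lhxy pxy dxy).
apply: eq_I => x.
by rewrite -(@fubini_lsc _ _ _ _ Hmu (h x) (lx x) (h0 x) (dx x)).
Qed.

End Sections.

(** * Dependent random choice with a weight on pairs of rows *)

Section DependentRandomChoice.
Context {R : realType} {d : measure_display} {G : borelGroupType d}.
Variable mu : {measure set G -> \bar R}.
Hypothesis Hmu : multiplicative_group mu.
Implicit Types (U V W A B P : set G) (x y z : G) (E : set (G * G)).
Local Notation m := (vol mu).
Local Notation I := (integ mu).

(** Pairs [x], [x'] in the column over [y], weighted by [q]. The weight will be the indicator that
    [x x'^-1] is popular; the weight 1 counts all pairs. *)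
Definition joint E (q : G -> G -> R) x x' y : R :=
  \1_E (x, y) * \1_E (x', y) * q x x'.

(** The degree of [x] in the weighted graph [q] on the column over [y]. *)
Definition degree E q y x := I (fun x' => joint E q x x' y).

Section Joint.
Variables (E : set (G * G)) (A B : set G) (q : G -> G -> R).
Hypotheses (oE : open E) (oA : opc A) (oB : opc B) (sE : E `<=` A `*` B).
Hypotheses (lq : lsc (fun p : G * G => q p.1 p.2)).
Hypotheses (q0 : forall x x', 0 <= q x x') (q1 : forall x x', q x x' <= 1).

Lemma joint_ge0 x x' y : 0 <= joint E q x x' y.
Proof.
apply: mulr_ge0; last exact: q0.
by apply: mulr_ge0; exact: indic_ge0.
Qed.

Lemma joint_le x x' y : joint E q x x' y <= \1_(col E y) x * \1_(col E y) x'.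
Proof.
rewrite /joint -!indic_col; apply: ler_piMr; last exact: q1.
by apply: mulr_ge0; exact: indic_ge0.
Qed.

Lemma lsc_joint : lsc (fun p : G * G * G => joint E q p.1.1 p.1.2 p.2).
Proof.
have c11 : continuous (fun p : G * G * G => p.1.1).
  move=> p; apply: (@continuous_comp _ _ _ (@fst (G * G)%type G) (@fst G G)).
    exact: continuous_fst.
  exact: continuous_fst.
have c12 : continuous (fun p : G * G * G => p.1.2).
  move=> p; apply: (@continuous_comp _ _ _ (@fst (G * G)%type G) (@snd G G)).
    exact: continuous_fst.
  exact: continuous_snd.
have c2 : continuous (fun p : G * G * G => p.2) by exact: continuous_snd.
apply: lscM.
- by move=> p; apply: mulr_ge0; exact: indic_ge0.
- by move=> p; exact: q0.
- apply: lscM; [by move=> p; exact: indic_ge0|by move=> p; exact: indic_ge0|..].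
    apply: (lsc_comp (h := fun p : G * G * G => (p.1.1, p.2)) _ (lsc_indic oE)).
    exact: continuous_pair.
  apply: (lsc_comp (h := fun p : G * G * G => (p.1.2, p.2)) _ (lsc_indic oE)).
  exact: continuous_pair.
- exact: (lsc_comp (h := fun p : G * G * G => p.1) (@continuous_fst _ _) lq).
Qed.

Lemma joint_props :
  [/\ forall y, lsc (degree E q y) /\ tame (degree E q y),
     tame (fun y => I (degree E q y)),
     forall x, tame (fun x' => m (row E x `&` row E x') * q x x'),
     tame (fun x => I (fun x' => m (row E x `&` row E x') * q x x')) &
     I (fun y => I (degree E q y)) =
     I (fun x => I (fun x' => m (row E x `&` row E x') * q x x'))].
Proof.
have dom x x' y : joint E q x x' y <= \1_(A `|` B) x * \1_(A `|` B) x' * \1_(A `|` B) y.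
  have [Exy|Exy] := pselect (E (x, y)); last first.
    rewrite /joint (indicF Exy) !mul0r.
    by apply: mulr_ge0; [apply: mulr_ge0; exact: indic_ge0|exact: indic_ge0].
  have [Ex'y|Ex'y] := pselect (E (x', y)); last first.
    rewrite /joint (indicF Ex'y) mulr0 mul0r.
    by apply: mulr_ge0; [apply: mulr_ge0; exact: indic_ge0|exact: indic_ge0].
  have [Ax By] := sE Exy; have [Ax' _] := sE Ex'y.
  rewrite (indicT (s := x)); last by left.
  rewrite (indicT (s := x')); last by left.
  rewrite (indicT (s := y)); last by right.
  by rewrite /joint (indicT Exy) (indicT Ex'y) !mul1r q1.
have [H1 H2 [H3 H4] H5 H6] := fubini3 Hmu (opcU oA oB) lsc_joint joint_ge0 dom.
have e x x' : I (fun y => joint E q x x' y) = m (row E x `&` row E x') * q x x'.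
  have ox := opc_row x oE sE oB; have ox' := opc_row x' oE sE oB.
  have oxx := opcI ox ox'.
  rewrite mulrC -(I_indic mu (proj1 oxx)) -(IZ Hmu _ (tame_indic oxx)).
  apply: eq_I => y; rewrite /joint [LHS]mulrC !indic_row; congr (_ * _).
  by rewrite indicI.
have e2 : (fun x => (fun x' => I (fun y => joint E q x x' y))) =
    (fun x x' => m (row E x `&` row E x') * q x x').
  by apply/funext => x; apply/funext => x'; exact: e.
have e3 : (fun x => I (fun x' => I (fun y => joint E q x x' y))) =
    (fun x => I (fun x' => m (row E x `&` row E x') * q x x')).
  by apply/funext => x; congr I; exact: (congr1 (fun f => f x) e2).
split.
- exact: H1.
- exact: H2.
- by move=> x; have := H3 x; rewrite (congr1 (fun f => f x) e2).
- by rewrite -e3.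
- by rewrite -e3.
Qed.

Lemma opc_colE y : opc (col E y). Proof. exact: opc_col oE sE oA. Qed.

Lemma degree_le y x : degree E q y x <= m (col E y) * \1_(col E y) x.
Proof.
have oc := opc_colE y.
rewrite mulrC -(I_indic mu (proj1 oc)) -(IZ Hmu _ (tame_indic oc)).
apply: (I_le Hmu); last by move=> x'; exact: joint_le.
  apply: (tame_le (g := fun x' => \1_(col E y) x * \1_(col E y) x')).
  - apply: lsc_measurable.
    apply: (lsc_comp (h := fun x' => ((x, x'), y)) _ lsc_joint).
    apply: continuous_pair; last by move=> z; exact: cvg_cst.
    by apply: continuous_pair => z; [exact: cvg_cst|exact: cvg_id].
  - by move=> x'; exact: joint_ge0.
  - by move=> x'; exact: joint_le.
  - by apply: tameZ; [exact: indic_ge0|exact: tame_indic].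
by apply: tameZ; [exact: indic_ge0|exact: tame_indic].
Qed.

Lemma I_degree_le y : I (degree E q y) <= m (col E y) ^+ 2.
Proof.
have oc := opc_colE y.
rewrite expr2 -{2}(I_indic mu (proj1 oc)) -(IZ Hmu _ (tame_indic oc)).
have [/(_ y)[_ t] _ _ _ _] := joint_props.
apply: (I_le Hmu t); last by move=> x; exact: degree_le.
by apply: tameZ; [exact: m_ge0|exact: tame_indic].
Qed.

End Joint.

Lemma degree_cst1 E A B y x : open E -> opc A -> E `<=` A `*` B ->
  degree E (fun _ _ => 1) y x = m (col E y) * \1_(col E y) x.
Proof.
move=> oE oA sE; have oc := opc_col y oE sE oA.
rewrite mulrC -(I_indic mu (proj1 oc)) -(IZ Hmu _ (tame_indic oc)).
by apply: eq_I => x'; rewrite /joint mulr1 !indic_col.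
Qed.

(* Dependent random choice: if the rows meet in measure at most [delta] outside
   the set where [q = 1], then the column through a suitable point has almost
   all of its pairs in that set. *)
Lemma good_column E A B (q : G -> G -> R) (eta : R) :
  open E -> opc A -> opc B -> E `<=` A `*` B -> 0 < m A -> 0 < m B -> 0 < eta ->
  eta * (m A * m B) <= I (fun x => m (row E x)) ->
  lsc (fun p : G * G => q p.1 p.2) ->
  (forall x x', 0 <= q x x') -> (forall x x', q x x' <= 1) ->
  (forall x x', q x x' = 1 \/
    m (row E x `&` row E x') <= eta ^+ 2 * m B / 32) ->
  exists y, eta ^+ 2 * m A ^+ 2 / 2 <= m (col E y) ^+ 2 /\
    7 / 8 * m (col E y) ^+ 2 <= I (degree E q y).
Proof.
move=> oE oA oB sE mA mB eta0 dens lq q0 q1 Hq.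
set a := m A in mA dens *; set b := m B in mB dens Hq *.
set delta := eta ^+ 2 * b / 32 in Hq.
have d0 : 0 <= delta.
  by apply: divr_ge0 => //; apply: mulr_ge0; [exact: sqr_ge0|exact: ltW].
have l1 : lsc (fun p : G * G => (1 : R)).
  by move=> p r r1; apply: filterE => ?.
have [_ tG tGx tGxx eG] := joint_props oE oA oB sE lq q0 q1.
have [_ tT tTx tTxx eT] := @joint_props E A B (fun _ _ => 1) oE oA oB sE l1
  (fun _ _ => ler01) (fun _ _ => lexx _).
have TE : (fun y => I (degree E (fun _ _ => 1) y)) = (fun y => m (col E y) ^+ 2).
  apply/funext => y; have oc := opc_col y oE sE oA.
  rewrite expr2 -{2}(I_indic mu (proj1 oc)) -(IZ Hmu _ (tame_indic oc)).
  by apply: eq_I => x; exact: degree_cst1 oE oA sE.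
rewrite TE in tT eT.
have [_ _ _ tcol ecol] := sections Hmu oE oA oB sE.
have tA := @tame_indic R _ _ _ oA; have tB := @tame_indic R _ _ _ oB.
(* A pair with [q < 1] has at most [delta] common columns, so all such pairs together cost at most
   [delta * a ^+ 2]. *)
have TG : I (fun y => m (col E y) ^+ 2) <=
    I (fun y => I (degree E q y)) + delta * a ^+ 2.
  rewrite eT eG.
  have -> : delta * a ^+ 2 = I (fun x => delta * a * \1_A x).
    by rewrite (IZ Hmu _ tA) (I_indic mu (proj1 oA)) expr2 mulrA.
  have tda : tame (fun x => delta * a * \1_A x).
    by apply: tameZ; [apply: mulr_ge0; [exact: d0|exact: ltW]|exact: tA].
  rewrite -(ID Hmu tGxx tda); apply: (I_le Hmu tTxx); first exact: tameD.
  move=> x.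
  have -> : delta * a * \1_A x = I (fun x' => delta * \1_A x * \1_A x').
    by rewrite (IZ Hmu _ tA) (I_indic mu (proj1 oA)) mulrAC.
  have tdx : tame (fun x' => delta * \1_A x * \1_A x').
    by apply: tameZ; [apply: mulr_ge0; [exact: d0|exact: indic_ge0]|exact: tA].
  rewrite -(ID Hmu (tGx x) tdx); apply: (I_le Hmu (tTx x)).
    exact: (tameD (tGx x) tdx).
  move=> x'; rewrite mulr1.
  have tail : 0 <= delta * \1_A x * \1_A x'.
    by apply: mulr_ge0; [apply: mulr_ge0; [exact: d0|exact: indic_ge0]|exact: indic_ge0].
  have [->|le_d] := Hq x x'; first by rewrite mulr1 lerDl.
  have [Ax|Ax] := pselect (A x); last first.
    rewrite (_ : _ `&` _ = set0) ?m0; last first.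
      by apply/seteqP; split => // y [/sE[]].
    by rewrite mul0r add0r.
  have [Ax'|Ax'] := pselect (A x'); last first.
    rewrite (_ : _ `&` _ = set0) ?m0; last first.
      by apply/seteqP; split => // y [_ /sE[]].
    by rewrite mul0r add0r.
  rewrite (indicT Ax) (indicT Ax') !mulr1; apply: (le_trans le_d).
  by rewrite lerDr; apply: mulr_ge0; [exact: m_ge0|exact: q0].
(* Second moment of the column measures: [2 s t <= t^2 + s^2] at the mean level [s = eta * a] takes
   the place of Cauchy-Schwarz. *)
have T_ge : eta ^+ 2 * a ^+ 2 * b <= I (fun y => m (col E y) ^+ 2).
  have tl : tame (fun y => 2 * (eta * a) * m (col E y)).
    by apply: tameZ; [apply: mulr_ge0 => //; apply: mulr_ge0; exact: ltW|exact: tcol].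
  have tb : tame (fun y => (eta * a) ^+ 2 * \1_B y).
    by apply: tameZ; [exact: sqr_ge0|exact: tB].
  have : I (fun y => 2 * (eta * a) * m (col E y)) <=
      I (fun y => m (col E y) ^+ 2 + (eta * a) ^+ 2 * \1_B y).
    apply: (I_le Hmu tl); first exact: (tameD tT tb).
    move=> y; have [By|By] := pselect (B y).
      rewrite (indicT By) mulr1; have := sqr_ge0 (m (col E y) - eta * a); lra.
    rewrite (indicF By) mulr0 addr0 (_ : col E y = set0) ?m0.
      by rewrite mulr0 expr2 mulr0.
    by apply/seteqP; split => // x /sE[].
  rewrite (ID Hmu tT tb) (IZ Hmu _ tcol) (IZ Hmu _ tB) (I_indic mu (proj1 oB)).
  rewrite -ecol -/b => H.
  have ea0 : 0 <= 2 * (eta * a) by apply: mulr_ge0 => //; apply: mulr_ge0; exact: ltW.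
  have := ler_wpM2l ea0 dens; rewrite exprMn in H; lra.
apply: contrapT => H.
(* In a column that is too small, one eighth of its square is below [eta^2 a^2 / 16]. Without a good
   column, one eighth of the second moment would be at most [(1/16 + 1/32) eta^2 a^2 b], while it is
   at least [eta^2 a^2 b / 8]. *)
have tc : tame (fun y => eta ^+ 2 * a ^+ 2 / 16 * \1_B y).
  apply: tameZ; last exact: tB.
  by apply: divr_ge0 => //; apply: mulr_ge0; exact: sqr_ge0.
have t78 : tame (fun y => 7 / 8 * m (col E y) ^+ 2) by apply: tameZ; [lra|exact: tT].
have : I (fun y => I (degree E q y)) <=
    I (fun y => 7 / 8 * m (col E y) ^+ 2 + eta ^+ 2 * a ^+ 2 / 16 * \1_B y).
  apply: (I_le Hmu tG); first exact: (tameD t78 tc).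
  move=> y; have Gle := I_degree_le oE oA oB sE lq q0 q1 y.
  have [By|By] := pselect (B y); last first.
    move: Gle; rewrite (_ : col E y = set0) ?m0; last first.
      by apply/seteqP; split => // x /sE[].
    by rewrite (indicF By) expr2 !mulr0 addr0.
  rewrite (indicT By) mulr1.
  have [T1|T1] := leP (eta ^+ 2 * a ^+ 2 / 2) (m (col E y) ^+ 2).
    have [G1|G1] := leP (7 / 8 * m (col E y) ^+ 2) (I (degree E q y)).
      by exfalso; apply: H; exists y.
    apply: (le_trans (ltW G1)); rewrite lerDl.
    by apply: divr_ge0 => //; apply: mulr_ge0; exact: sqr_ge0.
  lra.
rewrite (ID Hmu t78 tc) (IZ Hmu _ tT) (IZ Hmu _ tB) (I_indic mu (proj1 oB)) -/b.
have pos : 0 < eta ^+ 2 * a ^+ 2 * b.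
  by apply: mulr_gt0 => //; apply: mulr_gt0; exact: exprn_gt0.
move: TG; rewrite /delta; lra.
Qed.

End DependentRandomChoice.

(** * Small quotient sets from dense partial products *)

Section BalogSzemerediGowers.
Context {R : realType} {d : measure_display} {G : borelGroupType d}.
Variable mu : {measure set G -> \bar R}.
Hypothesis Hmu : multiplicative_group mu.
Implicit Types (U V W A B P Pi H S : set G) (x y z : G) (E : set (G * G)).
Local Notation m := (vol mu).
Local Notation I := (integ mu).

(** By symmetry of the popular set [P], the [x'] with [x x'^-1] in [P] form the translate [P x].
    Degrees thus become measures of subsets of one column, which can be intersected. *)
Lemma degree_popular E A B Pi (c : R) y x : open E -> opc A -> E `<=` A `*` B ->
  opc Pi -> 0 <= c ->
  degree mu E (fun x x' => \1_(popular mu Pi c) (x * x'^-1)%g) y x =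
  \1_(col E y) x * m (col E y `&` rset (popular mu Pi c) x).
Proof.
move=> oE oA sE oPi c0; have oc := opc_col y oE sE oA.
have oP := opc_rset x (opc_popular Hmu oPi c0).
have ocP := opcI oc oP.
rewrite -(I_indic mu (proj1 ocP)) -(IZ Hmu _ (tame_indic ocP)).
apply: eq_I => x'; rewrite /joint !indic_col -mulrA; congr (_ * _).
rewrite indicI /=; congr (_ * _); rewrite rsetE !indicE; congr ((_ : bool)%:R).
apply/idP/idP; rewrite !inE /= => /(popular_inv Hmu oPi);
  by rewrite invgM invgK.
Qed.

(** Every [y] common to the rows of [x] and [x'] gives [x x'^-1 = (x y) (x' y)^-1], so pairs with an
    unpopular quotient have small common rows and [good_column] applies. Two points of high degree
    in the resulting column share many neighbours [w], and each gives [x x'^-1 = (x w^-1) (w x'^-1)]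
    with both factors popular. *)
Lemma balog_szemeredi_gowers E A B Pi (eta : R) :
  open E -> opc A -> opc B -> E `<=` A `*` B -> 0 < m A -> 0 < m B -> 0 < eta ->
  eta * (m A * m B) <= I (fun x => m (row E x)) ->
  opc Pi -> (forall x y, E (x, y) -> Pi (x * y)%g) ->
  exists A', [/\ opc A', forall x, A' x -> exists y, E (x, y),
    eta * m A / 16 <= m A' &
    m (mulset A' (invset A')) * (eta ^+ 5 * (m A * m B ^+ 2)) <= 2 ^+ 12 * m Pi ^+ 4].
Proof.
move=> oE oA oB sE mA mB eta0 dens oPi EPi.
pose c := eta ^+ 2 * m B / 32.
have c0 : 0 < c by apply: divr_gt0 => //; apply: mulr_gt0 => //; exact: exprn_gt0.
pose P := popular mu Pi c.
have oP : opc P by apply: opc_popular => //; exact: ltW.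
pose q x x' : R := \1_P (x * x'^-1)%g.
have lq : lsc (fun p : G * G => q p.1 p.2).
  apply: (lsc_comp (h := fun p : G * G => (p.1 * p.2^-1)%g) _ (lsc_indic (proj1 oP))).
  apply: continuous_mulg; first exact: continuous_fst.
  by apply: continuous_invg; exact: continuous_snd.
have Hq x x' : q x x' = 1 \/ m (row E x `&` row E x') <= c.
  have [Pxx'|nP] := pselect (P (x * x'^-1)%g); [left|right]; first exact: indicT.
  have ox := opc_row x oE sE oB; have ox' := opc_row x' oE sE oB.
  apply: (@le_trans _ _ (conv mu Pi (invset Pi) (x * x'^-1)%g)); last first.
    by rewrite leNgt; apply/negP.
  apply: (conv_ge Hmu (t := x)); [exact: oPi|exact: opc_invset|exact: opcI|].
  move=> y [Exy Ex'y]; split; first exact: EPi.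
  by rewrite invsetE /= !invgM !invgK -!mulgA mulKg; exact: EPi.
have q0 x x' : 0 <= q x x' by exact: indic_ge0.
have q1 x x' : q x x' <= 1 by exact: indic_le1.
have [y [n2 deg]] := good_column Hmu oE oA oB sE mA mB eta0 dens lq q0 q1 Hq.
have oN := opc_col y oE sE oA; set N := col E y in n2 deg oN.
have dE x : degree mu E q y x = \1_N x * m (N `&` rset P x).
  exact: (degree_popular y x oE oA sE oPi (ltW c0)).
have [/(_ y)[ldeg tdeg] _ _ _ _] := joint_props Hmu oE oA oB sE lq q0 q1.
(* The threshold 3/4 lies below the average 7/8, which leaves [m N / 8] for [A'], and above 1/2, so
   that two points of [A'] have at least [m N / 2] common neighbours. *)
pose A' := [set x | 3 / 4 * m N < degree mu E q y x].
have n0 : 0 <= m N := m_ge0 mu N.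
have A'N x : A' x -> N x.
  rewrite /A' /= dE => h; apply: contrapT => Nx; move: h.
  by rewrite (indicF Nx) mul0r ltNge mulr_ge0.
have oA' : opc A' by apply: opc_sub oN A'N; exact: lsc_open.
have nN : eta * m A / 2 <= m N.
  rewrite -(ler_pXn2r (n := 2)) ?nnegrE//; last first.
    by apply: divr_ge0 => //; apply: mulr_ge0; exact: ltW.
  apply: le_trans n2; rewrite expr_div_n exprMn.
  have : 0 <= eta ^+ 2 * m A ^+ 2 by apply: mulr_ge0; exact: sqr_ge0.
  rewrite [X in _ / X]expr2; lra.
have nN0 : 0 < m N.
  by apply: lt_le_trans nN; apply: divr_gt0 => //; apply: mulr_gt0.
exists A'; split.
- exact: oA'.
- by move=> x /A'N Nx; exists y.
- have tA' := @tame_indic R _ _ _ oA'; have tN := @tame_indic R _ _ _ oN.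
  have t1 : tame (fun x => m N * \1_A' x) by apply: tameZ.
  have t2 : tame (fun x => 3 / 4 * m N * \1_N x).
    by apply: tameZ => //; apply: mulr_ge0.
  have : I (degree mu E q y) <= I (fun x => m N * \1_A' x + 3 / 4 * m N * \1_N x).
    apply: (I_le Hmu tdeg (tameD t1 t2)) => x.
    have dN := degree_le Hmu oE oA sE lq q0 q1 y x; rewrite -/N in dN.
    have [A'x|A'x] := pselect (A' x).
      rewrite (indicT A'x) (indicT (A'N _ A'x)) !mulr1.
      by move: dN; rewrite (indicT (A'N _ A'x)); lra.
    rewrite (indicF A'x) mulr0 add0r.
    have [Nx|Nx] := pselect (N x); last by move: dN; rewrite (indicF Nx) !mulr0.
    by rewrite (indicT Nx) mulr1 leNgt; apply/negP.
  rewrite (ID Hmu t1 t2) (IZ Hmu _ tA') (IZ Hmu _ tN) (I_indic mu (proj1 oA')).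
  rewrite (I_indic mu (proj1 oN)).
  move=> h; have : m N / 8 <= m A'.
    rewrite -(ler_pM2l nN0); move: deg h; rewrite expr2; lra.
  lra.
have oA'' := opc_invset oA'; have oAA := opc_mulset oA' oA''.
have half : m N / 2 * m (mulset A' (invset A')) <= m P * m P.
  apply: (markov_conv Hmu oP oP oAA); first by apply: divr_ge0.
  move=> _ [x A'x [_ [x' A'x' <-] <-]].
  have ox := opcI oN (opc_rset x oP); have ox' := opcI oN (opc_rset x' oP).
  have oxx := opcI ox ox'.
  apply: (@le_trans _ _ (m (invset ((N `&` rset P x) `&` (N `&` rset P x'))))).
    rewrite (m_invset Hmu (proj1 oxx)).
    have := mU_mI Hmu ox ox'.
    have : m ((N `&` rset P x) `|` (N `&` rset P x')) <= m N.
      by apply: (le_m Hmu) => //; [exact: opcU|move=> z [[]|[]]].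
    move: (A'x) (A'x'); rewrite /A' /= !dE (indicT (A'N _ A'x)) (indicT (A'N _ A'x')).
    lra.
  apply: (conv_ge Hmu (t := x) oP oP (opc_invset oxx)) => _ [w [[_ Pw] [_ Pw']] <-].
  move: Pw Pw'; rewrite !rsetE /= => Pw Pw'; split.
    by have := popular_inv Hmu oPi Pw; rewrite invgM invgK.
  by rewrite invgM invgK -mulgA mulKg.
have pop := m_popular Hmu oPi (ltW c0); rewrite -/P in pop.
have AA0 := m_ge0 mu (mulset A' (invset A')).
have step : m N / 2 * m (mulset A' (invset A')) * c ^+ 2 <= m Pi ^+ 4.
  apply: (@le_trans _ _ ((c * m P) ^+ 2)).
    rewrite (_ : (c * m P) ^+ 2 = c ^+ 2 * (m P * m P)); last by ring.
    rewrite [leLHS]mulrC; apply: ler_wpM2l half.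
    exact: sqr_ge0.
  rewrite (_ : m Pi ^+ 4 = (m Pi ^+ 2) ^+ 2); last by ring.
  have cP0 : 0 <= c * m P by apply: mulr_ge0; [exact: ltW|exact: m_ge0].
  by rewrite ler_pXn2r// ?nnegrE// sqr_ge0.
have : eta * m A / 4 * m (mulset A' (invset A')) * c ^+ 2 <= m Pi ^+ 4.
  apply: le_trans step; apply: ler_wpM2r; first exact: sqr_ge0.
  by apply: ler_wpM2r => //; lra.
set X := m (mulset A' (invset A')); set Y := m Pi ^+ 4.
(* The factor 4 and the square of the 32 in [c] make [2 ^+ 12]; [c ^+ 2] contributes four of the
   five factors [eta]. *)
rewrite (_ : eta * m A / 4 * X * c ^+ 2 =
    (2 ^+ 12)^-1 * (X * (eta ^+ 5 * (m A * m B ^+ 2)))).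
  by rewrite ler_pdivrMl// exprn_gt0.
by rewrite /c; field.
Qed.

End BalogSzemerediGowers.

(** * From dense partial products to approximate groups *)

Section CoveringByApproximateGroup.
Context {R : realType} {d : measure_display} {G : borelGroupType d}.
Variable mu : {measure set G -> \bar R}.
Hypothesis Hmu : multiplicative_group mu.
Implicit Types (U V W A B P Pi H S : set G) (x y z : G) (E : set (G * G)).
Local Notation m := (vol mu).
Local Notation I := (integ mu).

(** Lower semicontinuity of the row measure keeps [E0] open, and the rows removed have measure at
    most [c] each. Afterwards [E] stays dense over every subset of the remaining [x]. *)
Lemma thick_rows E A B (c : R) : open E -> opc A -> opc B -> E `<=` A `*` B ->
  0 <= c -> let E0 := E `&` [set p | c < m (row E p.1)] in
  open E0 /\ I (fun x => m (row E x)) <= I (fun x => m (row E0 x)) + c * m A.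
Proof.
move=> oE oA oB sE c0 E0; have [lr tr _ _ _] := sections Hmu oE oA oB sE.
have oE0 : open E0.
  apply: openI oE _; apply: lsc_open.
  by apply: (lsc_comp (h := @fst G G) _ lr); exact: continuous_fst.
split; first exact: oE0.
have sE0 : E0 `<=` A `*` B by move=> p [/sE].
have [_ tr0 _ _ _] := sections Hmu oE0 oA oB sE0.
have tA := @tame_indic R _ _ _ oA; have tcA := tameZ c0 tA.
rewrite -(I_indic mu (proj1 oA)) -(IZ Hmu _ tA) -(ID Hmu tr0 tcA).
apply: (I_le Hmu tr); first exact: tameD.
move=> x; have [cx|cx] := ltP c (m (row E x)).
  rewrite (_ : row E0 x = row E x).
    by rewrite lerDl; apply: mulr_ge0; [exact: c0|exact: indic_ge0].
  by apply/seteqP; split => y; [case|split].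
have [Ax|Ax] := pselect (A x).
  by rewrite (indicT Ax) mulr1; apply: (le_trans cx); rewrite lerDr; exact: m_ge0.
rewrite (indicF Ax) mulr0 addr0 (_ : row E x = set0) ?m0; first exact: m_ge0.
by apply/seteqP; split => // y /sE[].
Qed.

(** The sets [col E y] multiplied by [y] lie in [Pi], so few thick columns meet all the others.
    Where two of them meet, [x y = x' y'], hence [y] lies in [A^-1 A y']; the pigeonhole principle
    then picks one [y']. *)
Lemma cover_columns E A B Pi (c : R) : open E -> opc A -> opc B ->
  E `<=` A `*` B -> opc Pi -> (forall x y, E (x, y) -> Pi (x * y)%g) ->
  0 < m A -> 0 < m B -> 0 < c -> (forall x, A x -> c <= m (row E x)) ->
  exists y, c ^+ 2 * m A <=
    8 * m Pi * m B * m (B `&` rset (mulset (invset A) A) y).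
Proof.
move=> oE oA oB sE oPi EPi mA mB c0 Ec.
have [_ tr lc tc e] := sections Hmu oE oA oB sE.
have tA := @tame_indic R _ _ _ oA; have tB := @tame_indic R _ _ _ oB.
(* Half the guaranteed average column measure: columns below it carry at most
   [mu0 * m B = c * m A / 2] of [E]. *)
pose mu0 := c * m A / (2 * m B).
have mu00 : 0 < mu0 by apply: divr_gt0; apply: mulr_gt0.
pose B1 := [set y | mu0 < m (col E y)].
have sB1 : B1 `<=` B.
  move=> y By1; apply: contrapT => By; move: By1; rewrite /B1 /=.
  rewrite (_ : col E y = set0) ?m0; first by rewrite ltNge (ltW mu00).
  by apply/seteqP; split => // x /sE[].
have oB1 : opc B1 by apply: opc_sub oB sB1; exact: lsc_open.
have tB1 := @tame_indic R _ _ _ oB1.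
have lower : c * m A <= I (fun x => m (row E x)).
  rewrite -(I_indic mu (proj1 oA)) -(IZ Hmu _ tA).
  apply: (I_le Hmu _ tr); first by apply: tameZ => //; exact: ltW.
  move=> x; have [Ax|Ax] := pselect (A x); first by rewrite (indicT Ax) mulr1; exact: Ec.
  by rewrite (indicF Ax) mulr0; exact: m_ge0.
have upper : I (fun y => m (col E y)) <= m A * m B1 + mu0 * m B.
  have t1 : tame (fun y => m A * \1_B1 y) by apply: tameZ => //; exact: ltW.
  have t2 : tame (fun y => mu0 * \1_B y) by apply: tameZ => //; exact: ltW.
  rewrite -(I_indic mu (proj1 oB1)) -(IZ Hmu _ tB1) -(I_indic mu (proj1 oB)).
  rewrite -(IZ Hmu _ tB) -(ID Hmu t1 t2); apply: (I_le Hmu tc (tameD t1 t2)).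
  move=> y; have [By1|By1] := pselect (B1 y).
    rewrite (indicT By1) (indicT (sB1 _ By1)) !mulr1.
    have : m (col E y) <= m A.
      apply: (le_m Hmu (opc_col y oE sE oA) oA).
      by move=> x /sE[].
    lra.
  have le_mu0 : m (col E y) <= mu0 by rewrite leNgt; apply/negP.
  rewrite (indicF By1) mulr0 add0r; have [By|By] := pselect (B y).
    by rewrite (indicT By) mulr1.
  rewrite (indicF By) mulr0 (_ : col E y = set0) ?m0//.
  by apply/seteqP; split => // x /sE[].
have mB1 : c / 2 <= m B1.
  rewrite -(ler_pM2l mA); move: lower upper; rewrite e.
  rewrite (_ : mu0 * m B = c * m A / 2); first by lra.
  by rewrite /mu0; field; rewrite gt_eqF.
have [|s [sB sk cov]] := @covering _ _ _ _ Hmu B1 Pi (fun y => rset (col E y) y) mu0 mu00 oPi.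
  move=> y By1; have oc := opc_col y oE sE oA; split; first exact: opc_rset.
    by move=> _ [x Exy <-]; exact: EPi.
  by rewrite (m_rset Hmu _ (proj1 oc)); exact: ltW.
have oW := opc_mulset (opc_invset oA) oA.
have mB10 : 0 < m B1 by apply: lt_le_trans mB1; exact: divr_gt0.
have [||y ys Hy] := @pigeonhole _ _ _ _ Hmu B1 s
    (fun y => rset (mulset (invset A) A) y) oB1 mB10.
- by move=> y _; exact: opc_rset.
- move=> y By1; have [y' ys Hy] := cov y By1; exists y' => //.
  have [_ [[x Exy <-] [x' Ex'y' e']]] : rset (col E y) y `&` rset (col E y') y' !=set0.
    apply/set0P/eqP => e'; move: Hy; rewrite e' m0 ltNge => /negP; apply.
    by apply: divr_ge0; [exact: sqr_ge0|apply: mulr_ge0 => //; exact: m_ge0].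
  exists (x^-1 * x')%g; last by rewrite -mulgA e' mulKg.
  by apply: mem_mulset; [apply: mem_invset; exact: (proj1 (sE _ Exy))|exact: (proj1 (sE _ Ex'y'))].
exists y.
have oB1y := opcI oB1 (opc_rset y oW); have oBy := opcI oB (opc_rset y oW).
have H1 : m (B1 `&` rset (mulset (invset A) A) y) <= m (B `&` rset (mulset (invset A) A) y).
  by apply: (le_m Hmu) => // z [/sB1].
set M := m (B `&` _) in H1 *; set M1 := m (B1 `&` _) in Hy H1.
have M0 : 0 <= M by exact: m_ge0.
have : c / 2 <= 2 * (m Pi / mu0) * M.
  apply: (le_trans mB1); apply: (le_trans Hy).
  apply: (@le_trans _ _ ((size s)%:R * M)); first by apply: ler_wpM2l.
  exact: ler_wpM2r.
have cA : 0 < 2 * c * m A by apply: mulr_gt0 => //; apply: mulr_gt0.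
move=> /(ler_wpM2l (ltW cA)).
rewrite (_ : 2 * c * m A * (c / 2) = c ^+ 2 * m A); last by field.
rewrite (_ : 2 * c * m A * (2 * (m Pi / mu0) * M) = 8 * m Pi * m B * M) //.
by rewrite /mu0; field; rewrite !gt_eqF.
Qed.

(** The translate of a row by [x], or of a column by [y], lies in [Pi], so no section exceeds
    [m Pi]. *)
Lemma m_le_sections E A B Pi : open E -> opc A -> opc B -> E `<=` A `*` B ->
  opc Pi -> (forall x y, E (x, y) -> Pi (x * y)%g) ->
  I (fun x => m (row E x)) <= m Pi * m A /\ I (fun x => m (row E x)) <= m Pi * m B.
Proof.
move=> oE oA oB sE oPi EPi; have [_ tr _ tc e] := sections Hmu oE oA oB sE.
have tA := @tame_indic R _ _ _ oA; have tB := @tame_indic R _ _ _ oB.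
have mPi := m_ge0 mu Pi.
split; last rewrite e.
  rewrite -(I_indic mu (proj1 oA)) -(IZ Hmu _ tA).
  apply: (I_le Hmu tr); first exact: tameZ.
  move=> x; have [Ax|Ax] := pselect (A x); last first.
    rewrite (indicF Ax) mulr0 (_ : row E x = set0) ?m0//.
    by apply/seteqP; split => // y /sE[].
  have oc := opc_row x oE sE oB.
  rewrite (indicT Ax) mulr1 -(m_lset Hmu x (proj1 oc)).
  apply: (le_m Hmu (opc_lset x oc) oPi).
  by move=> _ [y Exy <-]; exact: EPi.
rewrite -(I_indic mu (proj1 oB)) -(IZ Hmu _ tB).
apply: (I_le Hmu tc); first exact: tameZ.
move=> y; have [By|By] := pselect (B y); last first.
  rewrite (indicF By) mulr0 (_ : col E y = set0) ?m0//.
  by apply/seteqP; split => // x /sE[].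
have oc := opc_col y oE sE oA.
rewrite (indicT By) mulr1 -(m_rset Hmu y (proj1 oc)).
apply: (le_m Hmu (opc_rset y oc) oPi).
by move=> _ [x Exy <-]; exact: EPi.
Qed.

(** The geometric mean [r] is given through its square, so that every estimate is polynomial. The
    parameter [k] bounds the ratio of [m (A' A'^-1)] to [m A']. *)
Lemma approximate_group_of_dense_products E A B Pi (L r : R) : open E -> opc A -> opc B -> E `<=` A `*` B ->
  opc Pi -> (forall x y, E (x, y) -> Pi (x * y)%g) -> 0 < m A -> 0 < m B ->
  1 <= L -> 0 < r -> r ^+ 2 = m A * m B ->
  m A * m B <= L * I (fun x => m (row E x)) -> m Pi <= L * r ->
  let k := 2 ^+ 22 * L ^+ 10 in
  exists H x y, [/\ approximate_group (2 ^+ 18 * k ^+ 12) H,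
    m H <= 64 * k ^+ 5 * L ^+ 2 * r, r <= 64 * L ^+ 3 * k * m H,
    m A <= 64 * L * k * m (A `&` lset x H) &
    m B <= 2 ^+ 11 * L ^+ 6 * k * m (B `&` rset H y)].
Proof.
move=> oE oA oB sE oPi EPi mA mB L1 r0 rE dens mPi k.
have L0 : 0 < L by exact: lt_le_trans L1.
have k0 : 0 < k by apply: mulr_gt0; exact: exprn_gt0.
set a := m A in mA rE dens *; set b := m B in mB rE dens *.
have [secA secB] := m_le_sections oE oA oB sE oPi EPi.
(* Sections have measure at most [m Pi <= L * r], so density [1 / L] bounds both [a] and [b] by
   [L^2 r]; as [r^2 = a b], neither can be much smaller than [r]. *)
have a_le : a <= L ^+ 2 * r.
  rewrite -(ler_pM2r mB); apply: (le_trans dens).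
  apply: (le_trans (ler_wpM2l (ltW L0) secB)).
  rewrite (_ : L ^+ 2 * r * b = L * (L * r * b)); last by ring.
  by apply: ler_wpM2l; [exact: ltW|apply: ler_wpM2r mPi; exact: ltW].
have b_le : b <= L ^+ 2 * r.
  rewrite -(ler_pM2l mA); apply: (le_trans dens).
  apply: (le_trans (ler_wpM2l (ltW L0) secA)).
  rewrite (_ : a * (L ^+ 2 * r) = L * (L * r * a)); last by ring.
  by apply: ler_wpM2l; [exact: ltW|apply: ler_wpM2r mPi; exact: ltW].
have r_le : r <= L ^+ 2 * a.
  rewrite -(ler_pM2r r0) -expr2 rE (_ : L ^+ 2 * a * r = a * (L ^+ 2 * r)); last by ring.
  by apply: ler_wpM2l b_le; exact: ltW.
(* Half the average row measure, so that the thick rows still have density [1 / (2 L)]. *)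
pose c := b / (2 * L).
have c0 : 0 < c by apply: divr_gt0 => //; apply: mulr_gt0.
have [oE0 dE0] := thick_rows oE oA oB sE (ltW c0).
set E0 := E `&` _ in oE0 dE0.
have sE0 : E0 `<=` A `*` B by move=> p [/sE].
have E0Pi x y : E0 (x, y) -> Pi (x * y)%g by case=> /EPi.
have eta0 : 0 < (2 * L)^-1 by rewrite invr_gt0; apply: mulr_gt0.
have dens0 : (2 * L)^-1 * (m A * m B) <= I (fun x => m (row E0 x)).
  rewrite -/a -/b ler_pdivrMl; last exact: mulr_gt0.
  have := ler_wpM2l (ltW L0) dE0.
  rewrite mulrDr (_ : L * (c * m A) = a * b / 2); first by lra.
  by rewrite /c -/a; field; rewrite gt_eqF.
have [A' [oA' A'E A'ge A'A']] :=
  balog_szemeredi_gowers Hmu oE0 oA oB sE0 mA mB eta0 dens0 oPi E0Pi.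
set a' := m A' in A'ge.
have a'ge : a <= 32 * L * a'.
  move: A'ge; rewrite -/a ler_pdivrMr// ler_pdivrMl; last exact: mulr_gt0.
  lra.
have a'0 : 0 < a'.
  by rewrite -(pmulr_rgt0 _ (_ : 0 < 32 * L)); [exact: lt_le_trans a'ge|exact: mulr_gt0].
(* With [eta = 1 / (2 L)] the quotient set has measure at most [2^12 (2 L)^5 L^4 a = 2^17 L^9 a],
   and [a <= 32 L a'] turns this into [k * a']. *)
have quot : m (mulset A' (invset A')) <= k * a'.
  set X := m (mulset _ _) in A'A' *.
  have Pi4 : m Pi ^+ 4 <= L ^+ 4 * (a * b) ^+ 2.
    rewrite -rE (_ : L ^+ 4 * (r ^+ 2) ^+ 2 = (L * r) ^+ 4); last by ring.
    by rewrite ler_pXn2r// nnegrE ?m_ge0//; apply: mulr_ge0; exact: ltW.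
  have Xa : X <= 2 ^+ 17 * L ^+ 9 * a.
    have ab2 : 0 < a * b ^+ 2 by apply: mulr_gt0 => //; exact: exprn_gt0.
    rewrite -(ler_pM2r ab2).
    have L5 : 0 < (2 * L) ^+ 5 by apply: exprn_gt0; exact: mulr_gt0.
    have := ler_wpM2l (ltW L5) (le_trans A'A' (ler_wpM2l (exprn_ge0 12 (ler0n R 2)) Pi4)).
    rewrite (_ : (2 * L) ^+ 5 * (X * _) = X * (a * b ^+ 2)); last first.
      by rewrite -/a -/b; field; rewrite gt_eqF.
    by move=> /le_trans; apply; rewrite le_eqVlt; apply/orP; left; apply/eqP; ring.
  apply: (le_trans Xa).
  have L9 : 0 <= 2 ^+ 17 * L ^+ 9 :> R by apply: mulr_ge0; apply: exprn_ge0 => //; exact: ltW.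
  apply: (le_trans (ler_wpM2l L9 a'ge)).
  by rewrite /k le_eqVlt; apply/orP; left; apply/eqP; ring.
have [S [oS Sinv _ [x0 A'x0 cx0] grow]] := small_quotient Hmu oA' a'0 quot.
have [x1 [A'x1 [s Ss _]]] : A' `&` lset x0 S !=set0.
  apply/set0P/eqP => e; move: cx0; rewrite e m0 mulr0 => /(lt_le_trans a'0).
  by rewrite ltxx.
(* Restricting to one left translate of [S] forces [A2^-1 A2] into [S S], so the translate of
   [A2^-1 A2] found for [B] lies in a translate of the same [H]. *)
pose A2 := A' `&` lset x0 S.
have oA2 : opc A2 by apply: opcI oA' _; exact: opc_lset.
have k2 : 0 < 2 * k by exact: mulr_gt0.
have mA2 : a <= 64 * L * k * m A2.
  apply: (le_trans a'ge).
  rewrite (_ : 64 * L * k * m A2 = 32 * L * (2 * k * m A2)); last by ring.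
  by apply: ler_wpM2l cx0; apply: mulr_ge0 => //; exact: ltW.
have Lk : 0 < 64 * L * k by apply: mulr_gt0 => //; exact: mulr_gt0.
have mA20 : 0 < m A2.
  by rewrite -(pmulr_rgt0 _ Lk); exact: lt_le_trans mA2.
have A2A : A2 `<=` A by move=> x [/A'E[y [/sE[]]]].
have oH := opc_mulset oS oS.
have mS : m A2 <= m S.
  rewrite -(m_lset Hmu x0 (proj1 oS)).
  by apply: (le_m Hmu oA2 (opc_lset x0 oS)) => x [].
have mSH : m S <= m (mulset S S).
  rewrite -(m_lset Hmu s (proj1 oS)); apply: (le_m Hmu (opc_lset s oS) oH).
  by move=> _ [t St <-]; exact: mem_mulset.
have a2S : a' <= 2 * k * m S.
  by apply: (le_trans cx0); apply: ler_wpM2l mS; exact: ltW.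
have A2H : mulset (invset A2) A2 `<=` mulset S S.
  move=> _ [_ [x [_ Sx] <-] [y [_ Sy] <-]].
  move: Sx Sy; rewrite !lsetE /= => Sx Sy.
  rewrite -{1}Sinv (_ : x^-1 * y = (x0^-1 * x)^-1 * (x0^-1 * y))%g.
    by apply: mem_mulset => //; exact: mem_invset.
  by rewrite invgM invgK -mulgA mulVKg.
pose E2 := E `&` [set p | A2 p.1].
have oE2 : open E2.
  apply: openI oE _; apply: (open_preimage (h := @fst G G)) (proj1 oA2).
  exact: continuous_fst.
have sE2 : E2 `<=` A2 `*` B by move=> p [/sE[_ Bp] A2p].
have E2Pi x y : E2 (x, y) -> Pi (x * y)%g by case=> /EPi.
have E2c x : A2 x -> c <= m (row E2 x).
  move=> A2x; rewrite (_ : row E2 x = row E x); last first.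
    by apply/seteqP; split => y; [case|split].
  by have [A'x _] := A2x; have [y [_ /ltW]] := A'E _ A'x.
have [y Hy] := cover_columns oE2 oA2 oB sE2 oPi E2Pi mA20 mB c0 E2c.
(* The factor [s^-1] puts [x0 S] inside the translate of [S S], because [s S] lies in [S S]. *)
exists (mulset S S), (x0 * s^-1)%g, y; split.
(* The growth bound for [S^5] is [(8 k^2)^5 k a'], with [a' <= 2 k m S]; the 4 comes from
   [approximate_group_sqr]. *)
- rewrite (_ : 2 ^+ 18 * k ^+ 12 = 4 * ((8 * k ^+ 2) ^+ 5 * k * (2 * k))); last by ring.
  apply: (approximate_group_sqr Hmu oS _ Sinv); first by exists s.
  apply: (le_trans (grow 4)).
  rewrite (_ : (8 * k ^+ 2) ^+ 5 * k * (2 * k) * m S =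
    (8 * k ^+ 2) ^+ 5 * (k * (2 * k * m S))); last by ring.
  apply: ler_wpM2l; last by apply: ler_wpM2l a2S; exact: ltW.
  by apply: exprn_ge0; apply: mulr_ge0 => //; exact: sqr_ge0.
- apply: (le_trans (grow 1)).
  rewrite (_ : 64 * k ^+ 5 * L ^+ 2 * r = (8 * k ^+ 2) ^+ 2 * (k * (L ^+ 2 * r))); last by ring.
  apply: ler_wpM2l; first exact: sqr_ge0.
  apply: ler_wpM2l; first exact: ltW.
  apply: le_trans a_le; apply: (le_m Hmu oA' oA).
  by move=> x /A'E[z [/sE[]]].
- apply: (le_trans r_le).
  rewrite (_ : 64 * L ^+ 3 * k * m (mulset S S) = L ^+ 2 * (64 * L * k * m (mulset S S))); last by ring.
  apply: ler_wpM2l; first exact: sqr_ge0.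
  apply: (le_trans mA2); apply: ler_wpM2l; first exact: ltW.
  exact: (le_trans mS mSH).
- apply: (le_trans mA2); apply: ler_wpM2l; first exact: ltW.
  apply: (le_m Hmu oA2); first by apply: opcI oA _; exact: opc_lset.
  move=> x A2x; split; first exact: A2A.
  have [_ [t St <-]] := A2x; exists (s * t)%g; first exact: mem_mulset.
  by rewrite mulgA mulgVK.
- set Y := m (B `&` rset (mulset (invset A2) A2) y) in Hy.
  have Y_le : Y <= m (B `&` rset (mulset S S) y).
    apply: (le_m Hmu).
    - by apply: opcI oB _; apply: opc_rset; exact: opc_mulset (opc_invset oA2) oA2.
    - by apply: opcI oB _; exact: opc_rset.
    - by move=> z [Bz [t St e]]; split; [exact: Bz|exists t; [exact: A2H|exact: e]].
  have Y0 : 0 <= Y by exact: m_ge0.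
  have LkL : 0 <= 2 ^+ 11 * L ^+ 6 * k.
    by apply: mulr_ge0; [apply: mulr_ge0; apply: exprn_ge0 => //|]; exact: ltW.
  apply: (@le_trans _ _ (2 ^+ 11 * L ^+ 6 * k * Y)); last by exact: ler_wpM2l.
  (* This is [Hy] with the value of [c] and [m Pi <= L * r] inserted. The factor [m A2] is then
     traded for [r] through [r <= L^2 a] and [mA2]. *)
  have H1 : b * m A2 <= 32 * L ^+ 3 * r * Y.
    have b0 : 0 < b / (4 * L ^+ 2).
      by apply: divr_gt0 => //; apply: mulr_gt0 => //; exact: exprn_gt0.
    rewrite -(ler_pM2l b0).
    rewrite (_ : b / (4 * L ^+ 2) * (b * m A2) = c ^+ 2 * m A2); last first.
      by rewrite /c; field; rewrite gt_eqF.
    apply: (le_trans Hy).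
    rewrite (_ : b / (4 * L ^+ 2) * (32 * L ^+ 3 * r * Y) = 8 * (L * r) * b * Y); last first.
      by field; rewrite gt_eqF.
    apply: (ler_wpM2r Y0); apply: ler_wpM2r; first exact: ltW.
    by apply: ler_wpM2l mPi.
  rewrite -(ler_pM2r r0).
  apply: (@le_trans _ _ (b * (L ^+ 2 * (64 * L * k * m A2)))).
    apply: ler_wpM2l; first exact: ltW.
    by apply: (le_trans r_le); apply: ler_wpM2l mA2; exact: sqr_ge0.
  rewrite (_ : b * _ = 64 * L ^+ 3 * k * (b * m A2)); last by ring.
  rewrite (_ : _ * r = 64 * L ^+ 3 * k * (32 * L ^+ 3 * r * Y)); last by ring.
  apply: ler_wpM2l H1; apply: mulr_ge0; last exact: ltW.
  by apply: mulr_ge0 => //; apply: exprn_ge0; exact: ltW.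
Qed.

End CoveringByApproximateGroup.

(** * The equivalences with real constants *)

Section RealForms.
Context {R : realType} {d : measure_display} {G : borelGroupType d}.
Variable mu : {measure set G -> \bar R}.
Hypothesis Hmu : multiplicative_group mu.
Implicit Types (A B H : set G) (x y z : G) (E : set (G * G)) (L : R).
Local Notation m := (vol mu).
Local Notation I := (integ mu).

Definition geomean A B : R := (m A) `^ (1 / 2) * (m B) `^ (1 / 2).

Definition prods E := [set (ab.1 * ab.2)%g | ab in E].

(** This and the next three definitions are the four statements with every implied constant replaced
    by one [L], free of divisions, and without the upper bounds that follow from inclusions. *)
Definition energy_ge L A B :=
  m A * m B * geomean A B <= L * I (fun z => conv mu A B z ^+ 2).

Definition partial_product_le L A B := exists E : set (G * G),
  [/\ open E, E `<=` A `*` B, m A * m B <= L * I (fun x => m (row E x)) &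
     m (prods E) <= L * geomean A B].

Definition product_subsets_le L A B := exists A' B' : set G,
  [/\ multiplicative_set A' /\ A' `<=` A, multiplicative_set B' /\ B' `<=` B,
     m A <= L * m A' /\ m B <= L * m B',
     m (mulset A' B') <= L * geomean A B & geomean A B <= L * m (mulset A' B')].

Definition approximate_group_covers L A B := exists (H : set G) (x y : G),
  [/\ approximate_group L H, m H <= L * geomean A B, geomean A B <= L * m H,
     m A <= L * m (A `&` lset x H) & m B <= L * m (B `&` rset H y)].

Section Fixed.
Variables (A B : set G).
Hypotheses (mA : multiplicative_set A) (mB : multiplicative_set B).

Let oA : opc A. Proof. by case: mA. Qed.
Let oB : opc B. Proof. by case: mB. Qed.
Let a0 : 0 < m A. Proof. by apply: (m_gt0 Hmu oA); case: mA. Qed.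
Let b0 : 0 < m B. Proof. by apply: (m_gt0 Hmu oB); case: mB. Qed.

Lemma geomean_gt0 : 0 < geomean A B.
Proof. by rewrite /geomean mulr_gt0 ?powR_gt0. Qed.

Lemma geomean_sqr : geomean A B ^+ 2 = m A * m B.
Proof.
have sq (t : R) : 0 < t -> (t `^ (1 / 2)) ^+ 2 = t.
  move=> t0; rewrite expr2 -powRD; last by rewrite gt_eqF// implybT.
  by rewrite (_ : 1 / 2 + 1 / 2 = 1) ?powRr1 ?ltW//; lra.
by rewrite /geomean exprMn !sq.
Qed.

Lemma opc_prods E : open E -> E `<=` A `*` B -> opc (prods E).
Proof.
move=> oE sE; apply: (@opc_sub _ _ (mulset A B)).
- rewrite (_ : prods E = \bigcup_x lset x (row E x)).
    apply: bigcup_open => x _; apply: open_lset.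
    exact: (proj1 (opc_row x oE sE oB)).
  apply/seteqP; split => z.
    by move=> [[x y] Exy <-]; exists x => //; exists y.
  by move=> [x _ [y Exy <-]]; exists (x, y).
- exact: opc_mulset.
by move=> _ [[x y] /sE[Ax By] <-]; exact: mem_mulset.
Qed.

Lemma tame_conv : tame (conv mu A B).
Proof. by have [] := conv_props Hmu oA oB. Qed.

Lemma tame_conv_integrand z : tame (fun x => \1_A x * \1_B (x^-1 * z)%g : R).
Proof.
apply: (tame_le (g := \1_A)) => [|x|x|]; last exact: tame_indic.
- apply: lsc_measurable; apply: lscM => [x|x||]; [exact: indic_ge0|exact: indic_ge0|..].
    exact: lsc_indic (proj1 oA).
  apply: (lsc_comp (h := fun x => (x^-1 * z)%g) _ (lsc_indic (proj1 oB))).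
  apply: continuous_mulg; first exact: invg_continuous.
  by move=> x; exact: cvg_cst.
- by apply: mulr_ge0; exact: indic_ge0.
- by apply: ler_piMr; [exact: indic_ge0|exact: indic_le1].
Qed.

Lemma tame_conv_sqr : tame (fun z => conv mu A B z ^+ 2).
Proof. exact: (tameM tame_conv tame_conv). Qed.

Lemma shear_sections E : open E -> E `<=` A `*` B ->
  tame (fun z => I (fun x => \1_E (x, (x^-1 * z)%g))) /\
  I (fun x => m (row E x)) = I (fun z => I (fun x => \1_E (x, (x^-1 * z)%g))).
Proof.
move=> oE sE; pose e x y : R := \1_E (x, y).
have lE : lsc (fun p : G * G => e p.1 p.2).
  by rewrite (_ : (fun p => _) = \1_E); [exact: lsc_indic|apply/funext => -[]].
have E0 x y : 0 <= e x y by exact: indic_ge0.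
have [_ _ t eq] := @I_shear _ _ _ _ Hmu e lE E0 (dominated2_indic oA oB sE).
split; first exact: t.
rewrite -eq; apply: eq_I => x.
rewrite -(I_indic mu (proj1 (opc_row x oE sE oB))).
by apply: eq_I => y; rewrite /e indic_row.
Qed.

(* The constant [t] makes [2 t f <= f^2 + t^2] as sharp as Cauchy-Schwarz. *)
Lemma energy_of_partial_product L : 1 <= L ->
  partial_product_le L A B -> energy_ge (L ^+ 3) A B.
Proof.
move=> L1 [E [oE sE dens mPi]].
have L0 : 0 < L by exact: lt_le_trans L1.
have r0 := geomean_gt0; have r2 := geomean_sqr.
rewrite /energy_ge; set r := geomean A B in r0 r2 mPi *.
have oPi := opc_prods oE sE.
have [tf fE] := shear_sections oE sE.
(* The amount of factorizations of [z] recorded in [E]: it lies below the convolution, vanishes off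
   [prods E], and integrates to the measure of [E]. *)
set f := (fun z => I _) in tf fE.
have fconv z : f z <= conv mu A B z.
  rewrite (convE mu z oA oB).
  have tc := tame_conv_integrand z.
  have le_x x : \1_E (x, (x^-1 * z)%g) <= \1_A x * \1_B (x^-1 * z)%g :> R.
    have [Ex|Ex] := pselect (E (x, (x^-1 * z)%g)).
      by have [Ax Bx] := sE _ Ex; rewrite (indicT Ex) (indicT Ax) (indicT Bx) mulr1.
    by rewrite (indicF Ex); apply: mulr_ge0; exact: indic_ge0.
  apply: (I_le Hmu _ tc le_x).
  apply: (tame_le _ _ le_x tc) => [|x]; last exact: indic_ge0.
  apply: lsc_measurable.
  apply: (lsc_comp (h := fun x => (x, (x^-1 * z)%g)) _ (lsc_indic oE)).
  apply: continuous_pair; first by move=> x; exact: cvg_id.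
  apply: continuous_mulg; first exact: invg_continuous.
  by move=> x; exact: cvg_cst.
have fPi z : ~ prods E z -> f z = 0.
  move=> nz; apply: integ_eq0 => x; apply: indicF => Ex; apply: nz.
  by exists (x, (x^-1 * z)%g) => //=; rewrite mulVKg.
have f0 z : 0 <= f z by apply: I_ge0 => x; exact: indic_ge0.
(* The maximizer of [2 t r^2 / L - t^2 L r], whose maximum is [r^3 / L^3]. *)
pose t := r / L ^+ 2.
have t0 : 0 < t by apply: divr_gt0 => //; exact: exprn_gt0.
have tPi := @tame_indic R _ _ _ oPi.
have t2Pi : tame (fun z => t ^+ 2 * \1_(prods E) z) by apply: tameZ => //; exact: sqr_ge0.
have t2 : 0 <= 2 * t by apply: mulr_ge0 => //; exact: ltW.
have : I (fun z => 2 * t * f z) <= I (fun z => conv mu A B z ^+ 2 + t ^+ 2 * \1_(prods E) z).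
  apply: (I_le Hmu (tameZ t2 tf) (tameD tame_conv_sqr t2Pi)) => z.
  have [Pz|Pz] := pselect (prods E z); last first.
    by rewrite (fPi _ Pz) (indicF Pz) !mulr0 addr0; exact: sqr_ge0.
  rewrite (indicT Pz) mulr1; have := sqr_ge0 (f z - t).
  have : f z ^+ 2 <= conv mu A B z ^+ 2.
    by rewrite ler_pXn2r// nnegrE; [exact: f0|exact: le_trans (f0 z) (fconv z)].
  lra.
rewrite (ID Hmu tame_conv_sqr t2Pi) (IZ Hmu _ tf) (IZ Hmu _ tPi) (I_indic mu (proj1 oPi)).
rewrite -fE => key.
have L3 : 0 <= L ^+ 3 by apply: exprn_ge0; exact: ltW.
have h1 : 2 * t * (m A * m B) <= 2 * t * (L * I (fun x => m (row E x))) by exact: ler_wpM2l.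
have h2 := ler_wpM2l (sqr_ge0 t) mPi.
have h3 := ler_wpM2l L3 key.
rewrite -r2 in h1 *.
have e1 : L ^+ 2 * (2 * t * r ^+ 2) = 2 * r ^+ 3 by rewrite /t; field; rewrite gt_eqF.
have e2 : L ^+ 3 * (t ^+ 2 * (L * r)) = r ^+ 3 by rewrite /t; field; rewrite gt_eqF.
have h1' := ler_wpM2l (sqr_ge0 L) h1.
have h2' := ler_wpM2l L3 h2.
rewrite e1 in h1'; rewrite e2 in h2'.
rewrite (_ : r ^+ 2 * r = r ^+ 3); last by ring.
rewrite (_ : L ^+ 2 * (2 * t * (L * _)) = L ^+ 3 * (2 * t * I (fun x => m (row E x)))) in h1'; last by ring.
move: h3; rewrite mulrDr; lra.
Qed.

(** Where the convolution is at most [t = r / (2 L)] it contributes at most [t r^2] to the energy,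
    half of what is guaranteed. On the remaining set [D] it is at most [r], so the pairs with
    product in [D] have measure at least [r^2 / (2 L)], while Markov's inequality gives
    [m D <= 2 L r]. *)
Lemma partial_product_of_energy L : 1 <= L ->
  energy_ge L A B -> partial_product_le (2 * L) A B.
Proof.
move=> L1; have L0 : 0 < L by exact: lt_le_trans L1.
have r0 := geomean_gt0; have r2 := geomean_sqr.
rewrite /energy_ge /partial_product_le; set r := geomean A B in r0 r2 *.
set En := I _ => en; pose t := r / (2 * L).
have t0 : 0 < t by apply: divr_gt0 => //; exact: mulr_gt0.
have [lc tc cI] := conv_props Hmu oA oB.
pose D := [set z | t < conv mu A B z].
have oD : opc D.
  apply: (@opc_sub _ _ (mulset A B)); [exact: lsc_open|exact: opc_mulset|].
  move=> z; rewrite /D /=; apply: contraPP => nz; apply/negP; rewrite -leNgt.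
  rewrite /conv (_ : _ `&` _ = set0) ?m0 ?(ltW t0)//; apply/seteqP; split => // y.
  move=> [Ay /mem_lset_inv Byz]; apply: nz.
  by rewrite -(mulVKg y z); exact: mem_mulset.
pose E := (A `*` B) `&` [set p | D (p.1 * p.2)%g].
have sE : E `<=` A `*` B by move=> p [].
have oE : open E.
  apply: openI; first exact: (open_setX (proj1 oA) (proj1 oB)).
  apply: (open_preimage (h := fun p : G * G => (p.1 * p.2)%g)) (proj1 oD).
  exact: mulg_continuous.
exists E; split; [exact: oE|exact: sE|..].
  have [tf fE] := shear_sections oE sE.
  have fD z : I (fun x => \1_E (x, (x^-1 * z)%g)) = \1_D z * conv mu A B z.
    have oAB := opc_conv z oA oB.
    rewrite /conv -(I_indic mu (proj1 oAB)) -(IZ Hmu _ (tame_indic oAB)).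
    apply: eq_I => x; have [Ex|Ex] := pselect (E (x, (x^-1 * z)%g)).
      have [[Ax Bx] Dz] := Ex; rewrite /= mulVKg in Dz.
      rewrite (indicT Ex) (indicT Dz) indicT ?mulr1//.
      by split; [exact: Ax|apply/mem_lset_inv; exact: Bx].
    rewrite (indicF Ex); have [Dz|Dz] := pselect (D z); last by rewrite (indicF Dz) mul0r.
    rewrite [X in _ * X]indicF ?mulr0// => -[Ax /mem_lset_inv Bx]; apply: Ex.
    by split => //=; rewrite mulVKg.
  rewrite fE (_ : (fun z => _) = (fun z => \1_D z * conv mu A B z)) in tf *; last first.
    by apply/funext => z; exact: fD.
  have conv_r z : conv mu A B z <= r.
    have [ca cb] := conv_le Hmu z oA oB.
    rewrite -(ler_pXn2r (n := 2)) ?nnegrE ?m_ge0 ?(ltW r0)// r2 expr2.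
    by apply: ler_pM => //; exact: m_ge0.
  have t1 : tame (fun z => r * (\1_D z * conv mu A B z)) by apply: tameZ => //; exact: ltW.
  have t2 : tame (fun z => t * conv mu A B z) by apply: tameZ => //; exact: ltW.
  have : En <= I (fun z => r * (\1_D z * conv mu A B z) + t * conv mu A B z).
    apply: (I_le Hmu tame_conv_sqr (tameD t1 t2)) => z.
    have c0 : 0 <= conv mu A B z := m_ge0 mu _.
    have [Dz|Dz] := pselect (D z).
      rewrite (indicT Dz) mul1r expr2; apply: (le_trans (ler_wpM2r c0 (conv_r z))).
      by rewrite lerDl; apply: mulr_ge0 => //; exact: ltW.
    rewrite (indicF Dz) mul0r mulr0 add0r expr2; apply: ler_wpM2r c0 _ _ _.
    by rewrite leNgt; apply/negP.
  rewrite (ID Hmu t1 t2) (IZ Hmu _ tf) (IZ Hmu _ tc) cI => h.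
  have h' := le_trans en (ler_wpM2l (ltW L0) h).
  rewrite -(ler_pM2r r0).
  rewrite mulrDr (_ : L * (t * (m A * m B)) = m A * m B * r / 2) in h'; last first.
    by rewrite /t; field; rewrite gt_eqF.
  move: h'; lra.
have oPi := opc_prods oE sE.
have : t * m D <= m A * m B.
  apply: (markov_conv Hmu oA oB oD); first exact: ltW.
  by move=> z; exact: ltW.
rewrite -r2 -ler_pdivlMl// => h.
apply: (@le_trans _ _ (m D)).
  by apply: (le_m Hmu oPi oD) => _ [[x y] [_ Dxy] <-].
apply: (le_trans h); rewrite le_eqVlt; apply/orP; left; apply/eqP.
by rewrite /t; field; rewrite !gt_eqF.
Qed.

Lemma approximate_group_of_partial_product L : 1 <= L ->
  partial_product_le L A B -> approximate_group_covers (2 ^+ 282 * L ^+ 120) A B.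
Proof.
move=> L1 [E [oE sE dens mPi]].
have L0 : 0 < L by exact: lt_le_trans L1.
have EPi x y : E (x, y) -> prods E (x * y)%g by move=> Exy; exists (x, y).
have [H [x [y [apH mH rH AH BH]]]] := approximate_group_of_dense_products Hmu oE oA oB sE (opc_prods oE sE) EPi a0 b0
  L1 geomean_gt0 geomean_sqr dens mPi.
(* The largest of the constants is [2^18 k^12] with [k = 2^22 L^10], which bounds the number of
   translates. *)
have bnd i j : (i <= 282)%N -> (j <= 120)%N -> 2 ^+ i * L ^+ j <= 2 ^+ 282 * L ^+ 120.
  move=> i1 j1; apply: ler_pM; [exact: exprn_ge0|by apply: exprn_ge0; exact: ltW|..].
    by apply: ler_weXn2l => //; rewrite ler1n.
  exact: ler_weXn2l.
set M := 2 ^+ 282 * L ^+ 120 in bnd *.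
exists H, x, y; split.
- have [mgH Hinv [X [Xinv XH cX HX]]] := apH; split => //; exists X; split => //.
  apply: (le_trans cX).
  by rewrite (_ : 2 ^+ 18 * _ = M)//; rewrite /M; ring.
- apply: (le_trans mH); apply: ler_wpM2r; first exact: ltW geomean_gt0.
  by rewrite (_ : 64 * _ * _ = 2 ^+ 116 * L ^+ 52); [exact: bnd|ring].
- apply: (le_trans rH); apply: ler_wpM2r; first exact: m_ge0.
  by rewrite (_ : 64 * _ * _ = 2 ^+ 28 * L ^+ 13); [exact: bnd|ring].
- apply: (le_trans AH); apply: ler_wpM2r; first exact: m_ge0.
  by rewrite (_ : 64 * _ * _ = 2 ^+ 28 * L ^+ 11); [exact: bnd|ring].
- apply: (le_trans BH); apply: ler_wpM2r; first exact: m_ge0.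
  by rewrite (_ : 2 ^+ 11 * _ * _ = 2 ^+ 33 * L ^+ 16); [exact: bnd|ring].
Qed.

(** With [A'] in [x H] and [B'] in [H y], the product lies in [x H H y], which is covered by at most
    [L] translates of [H] up to the outer shifts. Conversely [A' B'] contains a translate of [A']
    and one of [B'], which bounds the geometric mean. *)
Lemma product_subsets_of_approximate_group L : 1 <= L ->
  approximate_group_covers L A B -> product_subsets_le (L ^+ 2) A B.
Proof.
move=> L1 [H [x [y [[mgH Hinv [X [_ _ cX HX]]] mH rH AH BH]]]].
have L0 : 0 < L by exact: lt_le_trans L1.
have LL2 t : 0 <= t -> L * t <= L ^+ 2 * t.
  by move=> t0; apply: ler_wpM2r => //; rewrite expr2; apply: ler_peMl => //; exact: ltW.
have r0 := geomean_gt0; have r2 := geomean_sqr.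
rewrite /product_subsets_le; set r := geomean A B in r0 r2 mH rH *.
have oH : opc H by case: mgH.
have oA' := opcI oA (opc_lset x oH); have oB' := opcI oB (opc_rset y oH).
set A' := A `&` _ in AH oA'; set B' := B `&` _ in BH oB'.
have A'0 : 0 < m A' by rewrite -(pmulr_rgt0 _ L0); exact: lt_le_trans AH.
have B'0 : 0 < m B' by rewrite -(pmulr_rgt0 _ L0); exact: lt_le_trans BH.
have ne (U : set G) : 0 < m U -> U !=set0.
  by move=> U0; apply/set0P/eqP => e; rewrite e m0 ltxx in U0.
have [u A'u] := ne _ A'0; have [v B'v] := ne _ B'0.
have oAB := opc_mulset oA' oB'; have oHH := opc_mulset oH oH.
have A'AB : m A' <= m (mulset A' B').
  rewrite -(m_rset Hmu v (proj1 oA')); apply: (le_m Hmu (opc_rset v oA') oAB).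
  by move=> _ [w A'w <-]; exact: mem_mulset.
have B'AB : m B' <= m (mulset A' B').
  rewrite -(m_lset Hmu u (proj1 oB')); apply: (le_m Hmu (opc_lset u oB') oAB).
  by move=> _ [w B'w <-]; exact: mem_mulset.
have AB0 := m_ge0 mu (mulset A' B').
exists A', B'; split.
- by split; [split; [exact: ne|exact: (proj1 oA')|exact: (proj2 oA')]|move=> w []].
- by split; [split; [exact: ne|exact: (proj1 oB')|exact: (proj2 oB')]|move=> w []].
- split; first by apply: (le_trans AH); apply: LL2; exact: ltW.
  by apply: (le_trans BH); apply: LL2; exact: ltW.
- have : m (mulset A' B') <= m (mulset H H).
    rewrite -(m_lset Hmu x (proj1 oHH)) -(m_rset Hmu y (open_lset x (proj1 oHH))).
    apply: (le_m Hmu oAB); first by apply: opc_rset; exact: opc_lset.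
    move=> _ [_ [_ [h Hh <-]] [_ [_ [h' Hh' <-]] <-]].
    exists (x * (h * h'))%g; last by rewrite !mulgA.
    by exists (h * h')%g => //; exact: mem_mulset.
  move=> /le_trans; apply.
  have oD (z : G) : z \in (X : seq G) -> opc (lset z H) by move=> _; exact: opc_lset.
  apply: (@le_trans _ _ ((#|` X|)%:R * m H)).
    apply: (@le_trans _ _ (m (mulset H H `&` \big[setU/set0]_(z <- (X : seq G)) lset z H))).
      apply: (le_m Hmu oHH); first exact: opcI oHH (opc_bigU oD).
      move=> w Hw; split; first exact: Hw.
      have [z Xz [h Hh e]] := HX _ Hw; apply/mem_bigU; exists z; first exact: Xz.
      by exists h.
    apply: (le_trans (m_cover_le Hmu oHH oD)); apply: sum_le_const => z _.
    rewrite -(m_lset Hmu z (proj1 oH)).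
    by apply: (le_m Hmu) => [||w []]; [exact: opcI oHH (opc_lset z oH)|exact: opc_lset|].
  apply: (@le_trans _ _ (L * m H)); first by apply: ler_wpM2r cX; exact: m_ge0.
  by rewrite expr2 -mulrA; apply: ler_wpM2l mH; exact: ltW.
- apply: (@le_trans _ _ (L * m (mulset A' B'))); last exact: LL2.
  have LAB : 0 <= L * m (mulset A' B') by apply: mulr_ge0 => //; exact: ltW.
  rewrite -(ler_pXn2r (n := 2)) ?nnegrE ?(ltW r0)// r2 expr2.
  apply: ler_pM; [exact: ltW|exact: ltW|..].
    by apply: (le_trans AH); apply: ler_wpM2l A'AB; exact: ltW.
  by apply: (le_trans BH); apply: ler_wpM2l B'AB; exact: ltW.
Qed.

Lemma partial_product_of_product_subsets L : 1 <= L ->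
  product_subsets_le L A B -> partial_product_le (L ^+ 2) A B.
Proof.
move=> L1 [A' [B' [[mgA' sA'] [mgB' sB'] [AA' BB'] mAB _]]].
have L0 : 0 < L by exact: lt_le_trans L1.
have oA' : opc A' by case: mgA'.
have oB' : opc B' by case: mgB'.
exists (A' `*` B'); split.
- exact: open_setX (proj1 oA') (proj1 oB').
- by move=> p [/sA' ? /sB' ?].
- rewrite (@eq_I _ _ _ mu _ (fun x => m B' * \1_A' x)); last first.
    move=> x; have [A'x|A'x] := pselect (A' x).
      rewrite (indicT A'x) mulr1 (_ : row _ x = B')//.
      by apply/seteqP; split => [y []|y].
    rewrite (indicF A'x) mulr0 (_ : row _ x = set0) ?m0//.
    by apply/seteqP; split => [y []|y].
  rewrite (IZ Hmu _ (tame_indic oA')) (I_indic mu (proj1 oA')).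
  rewrite (_ : L ^+ 2 * (m B' * m A') = L * m A' * (L * m B')); last by ring.
  by apply: ler_pM => //; exact: ltW.
- rewrite (_ : prods _ = mulset A' B'); last first.
    apply/seteqP; split => z.
      by move=> [[x y] [A'x B'y] <-]; exact: mem_mulset.
    by move=> [x A'x [y B'y <-]]; exists (x, y).
  apply: (le_trans mAB); apply: ler_wpM2r; first exact: ltW geomean_gt0.
  by rewrite expr2; apply: ler_peMl => //; exact: ltW.
Qed.

End Fixed.
End RealForms.

(** * From implied constants to one real constant *)

Section Conversion.
Context {R : realType}.
Implicit Types (C K L x y : R).

Lemma lesssimE C K x y :
  lesssim C K x%:E y%:E <-> x <= C * K `^ C * y.
Proof. by rewrite /lesssim -EFinM lee_fin. Qed.

Lemma gtrsimE C K x y : 0 < C -> 1 <= K ->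
  gtrsim C K x%:E y%:E <-> y <= C * K `^ C * x.
Proof.
move=> C0 K1; have KC : 0 < K `^ C by rewrite powR_gt0// (lt_le_trans _ K1).
by rewrite /gtrsim -EFinM lee_fin powRN -invfM ler_pdivrMl// mulr_gt0.
Qed.

(** Raising [C] to [C1 >= 1] makes [L = C1 K^C1] at least 1. Then [c L^n = c C1^n K^(n C1)], and
    [C'] dominates both the coefficient and the exponent without depending on [K]. *)
Lemma powR_majorant (c C : R) n : 1 <= c -> 0 < C -> exists2 C', 0 < C' &
  forall K, 1 <= K -> exists L,
    [/\ 1 <= L, C * K `^ C <= L & c * L ^+ n <= C' * K `^ C'].
Proof.
move=> c1 C0; pose C1 := Num.max 1 C; pose C' := Num.max (c * C1 ^+ n) (C1 * n%:R).
have C11 : 1 <= C1 by rewrite le_max lexx.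
have C1C : C <= C1 by rewrite le_max lexx orbT.
have C1n : 1 <= C1 ^+ n by exact: exprn_ege1.
have C'1 : c * C1 ^+ n <= C' by rewrite le_max lexx.
have C'2 : C1 * n%:R <= C' by rewrite le_max lexx orbT.
exists C'.
  apply: lt_le_trans C'1; apply: mulr_gt0; first exact: lt_le_trans c1.
  exact: lt_le_trans C1n.
move=> K K1; exists (C1 * K `^ C1); split.
- rewrite -[leLHS]mulr1; apply: ler_pM => //.
  by rewrite -(powRr0 K); apply: ler_powR => //; exact: le_trans C11.
- apply: ler_pM => //; [exact: ltW|exact: powR_ge0|].
  exact: ler_powR.
- rewrite exprMn mulrA; apply: ler_pM => //.
  + by apply: mulr_ge0; [exact: le_trans c1|exact: le_trans C1n].
  + by apply: exprn_ge0; exact: powR_ge0.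
  + rewrite -powR_mulrn ?powR_ge0// -powRrM.
    exact: ler_powR.
Qed.

Definition scaled_statement :=
  forall (d : measure_display) (G : borelGroupType d),
    {measure set G -> \bar R} -> R -> set G -> set G -> Prop.

(** Hypotheses are weakened to a larger [L], and with [above] conclusions are weakened to a larger
    [C K^C]; only inequalities between the two are imposed, so [L] need not equal [C K^C]. *)
Definition below (P : statement R) (P' : scaled_statement) :=
  forall (d : measure_display) (G : borelGroupType d)
    (mu : {measure set G -> \bar R}), multiplicative_group mu ->
  forall A B : set G, multiplicative_set A -> multiplicative_set B ->
  forall C K L : R, 0 < C -> 1 <= K -> 1 <= L -> C * K `^ C <= L ->
    P d G mu C K A B -> P' d G mu L A B.

Definition above (P : statement R) (P' : scaled_statement) :=
  forall (d : measure_display) (G : borelGroupType d)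
    (mu : {measure set G -> \bar R}), multiplicative_group mu ->
  forall A B : set G, multiplicative_set A -> multiplicative_set B ->
  forall C K L : R, 0 < C -> 1 <= K -> 1 <= L -> L <= C * K `^ C ->
    P' d G mu L A B -> P d G mu C K A B.

Lemma implies_scaled (P Q : statement R) (P' Q' : scaled_statement) (c : R) n :
  1 <= c -> below P P' -> above Q Q' ->
  (forall (d : measure_display) (G : borelGroupType d)
    (mu : {measure set G -> \bar R}), multiplicative_group mu ->
   forall A B : set G, multiplicative_set A -> multiplicative_set B ->
   forall L : R, 1 <= L -> P' d G mu L A B -> Q' d G mu (c * L ^+ n) A B) ->
  implies_up_to_constants P Q.
Proof.
move=> c1 bP aQ PQ C C0; have [C' C'0 H] := powR_majorant n c1 C0.
exists C' => // d G mu Hmu K K1 A B mA mB PC.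
have [L [L1 CL LC]] := H K K1.
have L'1 : 1 <= c * L ^+ n.
  by rewrite -[leLHS]mulr1; apply: ler_pM => //; exact: exprn_ege1.
apply: (aQ d G mu Hmu A B mA mB C' K _ C'0 K1 L'1 LC).
by apply: (PQ d G mu Hmu A B mA mB L L1); exact: bP PC.
Qed.

Lemma implies_trans (P Q S : statement R) : implies_up_to_constants P Q ->
  implies_up_to_constants Q S -> implies_up_to_constants P S.
Proof.
move=> PQ QS C C0; have [C1 C10 H1] := PQ C C0; have [C2 C20 H2] := QS C1 C10.
exists C2 => // d G mu Hmu K K1 A B mA mB PC.
by apply: (H2 d G mu Hmu K K1 A B mA mB); exact: H1.
Qed.

End Conversion.

(** * The four statements in terms of real measures and integrals *)

Section Equivalences.
Context {R : realType} {d : measure_display} {G : borelGroupType d}.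
Variable mu : {measure set G -> \bar R}.
Hypothesis Hmu : multiplicative_group mu.
Variables (A B : set G).
Hypotheses (mA : multiplicative_set A) (mB : multiplicative_set B).
Local Notation m := (vol mu).
Local Notation I := (integ mu).

Let oA : opc A. Proof. by case: mA. Qed.
Let oB : opc B. Proof. by case: mB. Qed.
Let a0 : 0 < m A. Proof. by apply: (m_gt0 Hmu oA); case: mA. Qed.
Let b0 : 0 < m B. Proof. by apply: (m_gt0 Hmu oB); case: mB. Qed.

Lemma geomeanE : (mu A `^ (1 / 2) * mu B `^ (1 / 2))%E = (geomean mu A B)%:E.
Proof. by rewrite (opc_fin Hmu oA) (opc_fin Hmu oB) !poweR_EFin -EFinM. Qed.

Lemma threehalvesE :
  (mu A `^ (3 / 2) * mu B `^ (3 / 2))%E = (m A * m B * geomean mu A B)%:E.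
Proof.
have th (t : R) : 0 < t -> t `^ (3 / 2) = t * t `^ (1 / 2).
  move=> t0; rewrite -[X in _ = X * _](powRr1 (ltW t0)) -powRD; last by rewrite gt_eqF// implybT.
  by congr (_ `^ _); lra.
rewrite (opc_fin Hmu oA) (opc_fin Hmu oB) !poweR_EFin -EFinM !th//.
by rewrite /geomean mulrACA.
Qed.

Lemma energyE : energy mu A B = (I (fun z => conv mu A B z ^+ 2))%:E.
Proof.
rewrite -(I_EFin Hmu (tame_conv_sqr Hmu mA mB)) /energy.
apply: eq_integral => z _; rewrite /convolution.
rewrite (I_EFin Hmu (tame_conv_integrand mA mB z)) -(convE mu z oA oB).
by rewrite EFin_expe.
Qed.

Lemma product_measureE E : open E -> E `<=` A `*` B ->
  (mu \x mu)%E E = (I (fun x => m (row E x)))%:E.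
Proof.
move=> oE sE; have [_ t _ _ _] := sections Hmu oE oA oB sE.
rewrite -(I_EFin Hmu t) /product_measure1; apply: eq_integral => x _ /=.
rewrite (_ : xsection E x = row E x) ?(opc_fin Hmu (opc_row x oE sE oB))//.
by apply/seteqP; split => y; rewrite /xsection /row /= inE.
Qed.

Variables (C K L : R).
Hypotheses (C0 : 0 < C) (K1 : 1 <= K) (L1 : 1 <= L).
Let K0 : 0 <= C * K `^ C. Proof. by apply: mulr_ge0; [exact: ltW|exact: powR_ge0]. Qed.

Lemma energy_below : C * K `^ C <= L ->
  large_energy mu C K A B -> energy_ge mu L A B.
Proof.
move=> CL; rewrite /large_energy energyE threehalvesE gtrsimE// => h.
by apply: (le_trans h); apply: ler_wpM2r CL; apply: I_ge0 => z; exact: sqr_ge0.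
Qed.

Lemma energy_above : L <= C * K `^ C ->
  energy_ge mu L A B -> large_energy mu C K A B.
Proof.
move=> CL h; rewrite /large_energy energyE threehalvesE gtrsimE//.
by apply: (le_trans h); apply: ler_wpM2r CL; apply: I_ge0 => z; exact: sqr_ge0.
Qed.

Lemma partial_product_below : C * K `^ C <= L ->
  small_partial_product_set mu C K A B -> partial_product_le mu L A B.
Proof.
move=> CL [E [oE sE dens small]]; exists E.
have oPi := opc_prods mA mB oE sE.
rewrite (product_measureE oE sE) (opc_fin Hmu oA) (opc_fin Hmu oB) -EFinM gtrsimE// in dens.
rewrite geomeanE (opc_fin Hmu oPi) lesssimE in small.
split; [exact: oE|exact: sE|..].
  by apply: (le_trans dens); apply: ler_wpM2r CL; apply: I_ge0 => z; exact: m_ge0.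
apply: (le_trans small); apply: ler_wpM2r CL; exact: ltW (geomean_gt0 Hmu mA mB).
Qed.

Lemma partial_product_above : L <= C * K `^ C ->
  partial_product_le mu L A B -> small_partial_product_set mu C K A B.
Proof.
move=> CL [E [oE sE dens small]]; exists E.
have oPi := opc_prods mA mB oE sE.
split; [exact: oE|exact: sE|..].
  rewrite (product_measureE oE sE) (opc_fin Hmu oA) (opc_fin Hmu oB) -EFinM gtrsimE//.
  by apply: (le_trans dens); apply: ler_wpM2r CL; apply: I_ge0 => z; exact: m_ge0.
rewrite geomeanE (opc_fin Hmu oPi) lesssimE.
apply: (le_trans small); apply: ler_wpM2r CL; exact: ltW (geomean_gt0 Hmu mA mB).
Qed.

Lemma product_subsets_below : C * K `^ C <= L ->
  small_product_subsets mu C K A B -> product_subsets_le mu L A B.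
Proof.
move=> CL [A' [B' [[mA' sA'] [mB' sB'] simA simB simAB]]]; exists A', B'.
have oA' : opc A' by case: mA'.
have oB' : opc B' by case: mB'.
have oAB := opc_mulset oA' oB'.
rewrite (opc_fin Hmu oA) (opc_fin Hmu oA') in simA.
rewrite (opc_fin Hmu oB) (opc_fin Hmu oB') in simB.
rewrite geomeanE (opc_fin Hmu oAB) in simAB.
have [_ /(gtrsimE _ _ C0 K1) hA] := simA; have [_ /(gtrsimE _ _ C0 K1) hB] := simB.
have [/lesssimE h1 /(gtrsimE _ _ C0 K1) h2] := simAB.
split; [by []|by []|split|..].
- by apply: (le_trans hA); apply: ler_wpM2r CL; exact: m_ge0.
- by apply: (le_trans hB); apply: ler_wpM2r CL; exact: m_ge0.
- by apply: (le_trans h1); apply: ler_wpM2r CL; exact: ltW (geomean_gt0 Hmu mA mB).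
- by apply: (le_trans h2); apply: ler_wpM2r CL; exact: m_ge0.
Qed.

(** Inclusion gives the upper estimate because [C K^C >= L >= 1]. *)
Lemma sim_subset (U V : set G) : L <= C * K `^ C -> opc U -> opc V -> U `<=` V ->
  m V <= L * m U -> sim C K (mu U) (mu V).
Proof.
move=> CL oU oV sUV h; rewrite (opc_fin Hmu oU) (opc_fin Hmu oV); split.
  apply/lesssimE; apply: (le_trans (le_m Hmu oU oV sUV)).
  by apply: ler_peMl; [exact: m_ge0|exact: le_trans CL].
apply/gtrsimE => //; apply: (le_trans h); apply: ler_wpM2r CL; exact: m_ge0.
Qed.

Lemma product_subsets_above : L <= C * K `^ C ->
  product_subsets_le mu L A B -> small_product_subsets mu C K A B.
Proof.
move=> CL [A' [B' [[mA' sA'] [mB' sB'] [hA hB] h1 h2]]]; exists A', B'.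
have oA' : opc A' by case: mA'.
have oB' : opc B' by case: mB'.
have oAB := opc_mulset oA' oB'.
split; [by []|by []|exact: sim_subset|exact: sim_subset|].
rewrite geomeanE (opc_fin Hmu oAB); split; [apply/lesssimE|apply/gtrsimE => //].
  by apply: (le_trans h1); apply: ler_wpM2r CL; exact: ltW (geomean_gt0 Hmu mA mB).
by apply: (le_trans h2); apply: ler_wpM2r CL; exact: m_ge0.
Qed.

Lemma approximate_group_le (k l : R) (H : set G) : k <= l ->
  approximate_group k H -> approximate_group l H.
Proof.
move=> kl [mgH Hinv [X [Xinv XH cX HX]]]; split => //; exists X; split => //.
exact: le_trans cX kl.
Qed.

Lemma approximate_group_below : C * K `^ C <= L ->
  covered_by_approximate_group mu C K A B -> approximate_group_covers mu L A B.
Proof.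
move=> CL [H [x [y [apH simH simA simB]]]]; exists H, x, y.
have oH : opc H by have [[]] := apH.
have oAx := opcI oA (opc_lset x oH); have oBy := opcI oB (opc_rset y oH).
rewrite geomeanE (opc_fin Hmu oH) in simH.
rewrite (opc_fin Hmu oA) (opc_fin Hmu oAx) in simA.
rewrite (opc_fin Hmu oB) (opc_fin Hmu oBy) in simB.
have [_ /(gtrsimE _ _ C0 K1) hA] := simA; have [_ /(gtrsimE _ _ C0 K1) hB] := simB.
have [/lesssimE h1 /(gtrsimE _ _ C0 K1) h2] := simH.
split.
- exact: approximate_group_le apH.
- by apply: (le_trans h1); apply: ler_wpM2r CL; exact: ltW (geomean_gt0 Hmu mA mB).
- by apply: (le_trans h2); apply: ler_wpM2r CL; exact: m_ge0.
- by apply: (le_trans hA); apply: ler_wpM2r CL; exact: m_ge0.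
- by apply: (le_trans hB); apply: ler_wpM2r CL; exact: m_ge0.
Qed.

Lemma approximate_group_above : L <= C * K `^ C ->
  approximate_group_covers mu L A B -> covered_by_approximate_group mu C K A B.
Proof.
move=> CL [H [x [y [apH h1 h2 hA hB]]]]; exists H, x, y.
have oH : opc H by have [[]] := apH.
have oAx := opcI oA (opc_lset x oH); have oBy := opcI oB (opc_rset y oH).
split.
- exact: approximate_group_le apH.
- rewrite geomeanE (opc_fin Hmu oH); split; [apply/lesssimE|apply/gtrsimE => //].
    by apply: (le_trans h1); apply: ler_wpM2r CL; exact: ltW (geomean_gt0 Hmu mA mB).
  by apply: (le_trans h2); apply: ler_wpM2r CL; exact: m_ge0.
- by apply: sim_subset => // z [].
- by apply: sim_subset => // z [].
Qed.

End Equivalences.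

(** * Closing the cycle of implications *)

Theorem theorem5p4 (R : realType) :
  equivalent_up_to_constants
    (@large_energy R) (@small_partial_product_set R) /\
  equivalent_up_to_constants
    (@large_energy R) (@small_product_subsets R) /\
  equivalent_up_to_constants
    (@large_energy R) (@covered_by_approximate_group R) /\
  equivalent_up_to_constants
    (@small_partial_product_set R) (@small_product_subsets R) /\
  equivalent_up_to_constants
    (@small_partial_product_set R) (@covered_by_approximate_group R) /\
  equivalent_up_to_constants
    (@small_product_subsets R) (@covered_by_approximate_group R).
Proof.
have h12 : implies_up_to_constants (@large_energy R) (@small_partial_product_set R).
  apply: (@implies_scaled _ _ _ (@energy_ge R) (@partial_product_le R) 2 1).
  - by rewrite ler1n.
  - by move=> d G mu Hmu A B mA mB C K L C0 K1 _; exact: energy_below.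
  - by move=> d G mu Hmu A B mA mB C K L C0 K1 _; exact: partial_product_above.
  - by move=> d G mu Hmu A B mA mB L L1; rewrite expr1; exact: partial_product_of_energy.
have h21 : implies_up_to_constants (@small_partial_product_set R) (@large_energy R).
  apply: (@implies_scaled _ _ _ (@partial_product_le R) (@energy_ge R) 1 3).
  - exact: lexx.
  - by move=> d G mu Hmu A B mA mB C K L C0 K1 _; exact: partial_product_below.
  - by move=> d G mu Hmu A B mA mB C K L C0 K1 _; exact: energy_above.
  - by move=> d G mu Hmu A B mA mB L L1; rewrite mul1r; exact: energy_of_partial_product.
have h24 : implies_up_to_constants (@small_partial_product_set R)
    (@covered_by_approximate_group R).
  apply: (@implies_scaled _ _ _ (@partial_product_le R) (@approximate_group_covers R)
    (2 ^+ 282) 120).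
  - by apply: exprn_ege1; rewrite ler1n.
  - by move=> d G mu Hmu A B mA mB C K L C0 K1 _; exact: partial_product_below.
  - by move=> d G mu Hmu A B mA mB C K L C0 K1 L1; exact: approximate_group_above.
  - by move=> d G mu Hmu A B mA mB L L1; exact: approximate_group_of_partial_product.
have h43 : implies_up_to_constants (@covered_by_approximate_group R)
    (@small_product_subsets R).
  apply: (@implies_scaled _ _ _ (@approximate_group_covers R) (@product_subsets_le R) 1 2).
  - exact: lexx.
  - by move=> d G mu Hmu A B mA mB C K L C0 K1 _; exact: approximate_group_below.
  - by move=> d G mu Hmu A B mA mB C K L C0 K1 L1; exact: product_subsets_above.
  - move=> d G mu Hmu A B mA mB L L1; rewrite mul1r.
    exact: product_subsets_of_approximate_group.
have h32 : implies_up_to_constants (@small_product_subsets R)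
    (@small_partial_product_set R).
  apply: (@implies_scaled _ _ _ (@product_subsets_le R) (@partial_product_le R) 1 2).
  - exact: lexx.
  - by move=> d G mu Hmu A B mA mB C K L C0 K1 _; exact: product_subsets_below.
  - by move=> d G mu Hmu A B mA mB C K L C0 K1 _; exact: partial_product_above.
  - move=> d G mu Hmu A B mA mB L L1; rewrite mul1r.
    exact: partial_product_of_product_subsets.
have h23 := implies_trans h24 h43; have h42 := implies_trans h43 h32.
have h13 := implies_trans h12 h23; have h14 := implies_trans h12 h24.
have h31 := implies_trans h32 h21; have h41 := implies_trans h42 h21.
have h34 := implies_trans h32 h24.
by do !split.
Qed.
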